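(* Let $n\geq 3$ and let $S^n_+$ be the closed $n$-dimensional hemisphere with standard round metric $g_0$. Let $g$ be a smooth Riemannian metric on $S^n_+$ which is conformal to $g_0$. Suppose that (1) $Q_g\geq Q_0$ on $S^n_+$, where $Q_0$ is the (constant) $Q$ curvature of $g_0$; (2) the metric induced by $g$ on $\partial S^n_+$ coincides with the metric induced by $g_0$ on $\partial S^n_+$; (3) $\partial S^n_+$ is totally geodesic with respect to $g$; (4) the scalar curvature $R_g$ of $g$ satisfies $R_g\geq n(n-1)$ on $\partial S^n_+$. Then $g=g_0$.
   Context: For a smooth Riemannian manifold $(M,g)$ of dimension $n\geq 3$, with Ricci tensor $Ric$ and scalar curvature $R$, set $$J=\frac{R}{2(n-1)},\qquad A=\frac{1}{n-2}\left(Ric-Jg\right).$$ The $Q$ curvature of $g$ is $$Q_g=-\Delta J-2|A|^2+\frac n2 J^2,$$ where $\Delta$ is the Laplace–Beltrami operator (trace of the Hessian) and the norm is taken with respect to $g$. The round metric $g_0$ is the metric of the unit sphere (sectional curvature $1$), for which $Q_0=\frac{(n-2)n(n+2)}{8}$. ''Conformal to $g_0$'' means that $g=\phi g_0$ for a positive smooth function $\phi$ on $S^n_+$ (including the boundary). *)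

(* Defs.v *)
(* The closed hemisphere is the subset of R^(n+1) cut out by |p| = 1 and
   p_(n+1) >= 0.  Stereographic projection from the south pole is a global
   chart identifying it with the closed unit ball of R^n (the boundary
   corresponding to the unit sphere), and differential operators on the
   hemisphere are computed in this chart by the classical coordinate
   formulas.  The topology of 'rV[R]_n comes from the sup norm, so the
   Euclidean length is always written with [dot]. *)
From HB Require Import structures.
From mathcomp Require Import all_boot all_order all_algebra.
From mathcomp Require Import all_classical all_reals all_analysis.
Set Implicit Arguments.
Unset Strict Implicit.
Unset Printing Implicit Defensive.
Import Order.TTheory GRing.Theory Num.Theory.
Import numFieldNormedType.Exports.
Local Open Scope classical_set_scope.
Local Open Scope ring_scope.

Section EuclideanBall.
Context {R : realType}.

Definition dot n (u v : 'rV[R]_n) : R := \sum_(i < n) u 0 i * v 0 i.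

Definition obal n : set 'rV[R]_n := [set x | dot x x < 1].
Definition cbal n : set 'rV[R]_n := [set x | dot x x <= 1].
Definition sphere n : set 'rV[R]_n := [set x | dot x x = 1].

Definition pderiv n (i : 'I_n) (f : 'rV[R]_n -> R) : 'rV[R]_n -> R :=
  fun x => 'D_(delta_mx 0 i) f x.

Definition pderivs n (s : seq 'I_n) (f : 'rV[R]_n -> R) : 'rV[R]_n -> R :=
  foldr (@pderiv n) f s.

Definition smooth_on n (U : set 'rV[R]_n) (f : 'rV[R]_n -> R) : Prop :=
  forall (s : seq 'I_n) x, U x -> differentiable (pderivs s f) x.

(* Smoothness up to the boundary: local smooth extendability. *)
Definition smooth_cbal n (f : 'rV[R]_n -> R) : Prop :=
  forall x, cbal x ->
    exists (U : set 'rV[R]_n) (F : 'rV[R]_n -> R),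
      [/\ open_nbhs x U, smooth_on U F
        & forall y, U y -> cbal y -> F y = f y].

(* Partial derivative of a function on the closed ball.  Taking the limit from
   the interior makes it depend only on the values of [f] on the closed ball;
   for [f] smooth on the closed ball it is the ordinary partial derivative at
   interior points, and that of any local smooth extension at boundary
   points. *)
Definition bderiv n (i : 'I_n) (f : 'rV[R]_n -> R) : 'rV[R]_n -> R :=
  fun x => lim (pderiv i f y @[y --> within (@obal n) (nbhs x)]).

End EuclideanBall.

(* Riemannian geometry on the closed unit ball: [G x i j] is g_ij(x). *)
Section Coordinates.
Context {R : realType} {n : nat}.
Variable G : 'rV[R]_n -> 'M[R]_n.

Local Notation g i j := (fun x => G x i j).

Definition ginv (x : 'rV[R]_n) : 'M[R]_n := invmx (G x).

(* Gamma^k_ij *)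
Definition christoffel (k i j : 'I_n) (x : 'rV[R]_n) : R :=
  2^-1 * \sum_(l < n) ginv x k l *
    (bderiv i (g j l) x + bderiv j (g i l) x - bderiv l (g i j) x).

(* The l-th component of R(d_i, d_j) d_k, where
   R(X, Y) = [nabla_X, nabla_Y] - nabla_[X, Y]. *)
Definition riemann (l k i j : 'I_n) (x : 'rV[R]_n) : R :=
  bderiv i (christoffel l j k) x - bderiv j (christoffel l i k) x
  + \sum_(m < n) (christoffel l i m x * christoffel m j k x
                  - christoffel l j m x * christoffel m i k x).

Definition ricci (x : 'rV[R]_n) : 'M[R]_n :=
  \matrix_(j, k) \sum_(i < n) riemann i k i j x.

Definition trace_metric (T : 'M[R]_n) (x : 'rV[R]_n) : R :=
  \sum_(i < n) \sum_(j < n) ginv x i j * T i j.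

Definition normsq_metric (T : 'M[R]_n) (x : 'rV[R]_n) : R :=
  \sum_(i < n) \sum_(j < n) \sum_(k < n) \sum_(l < n)
    ginv x i k * ginv x j l * T i j * T k l.

Definition scalar_curv (x : 'rV[R]_n) : R := trace_metric (ricci x) x.

Definition Jcurv (x : 'rV[R]_n) : R := scalar_curv x / (2 * (n%:R - 1)).

Definition schouten (x : 'rV[R]_n) : 'M[R]_n :=
  (n%:R - 2)^-1 *: (ricci x - Jcurv x *: G x).

Definition hessian (f : 'rV[R]_n -> R) (x : 'rV[R]_n) : 'M[R]_n :=
  \matrix_(i, j) (bderiv i (bderiv j f) x
                  - \sum_(k < n) christoffel k i j x * bderiv k f x).

Definition laplacian (f : 'rV[R]_n -> R) (x : 'rV[R]_n) : R :=
  trace_metric (hessian f x) x.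

Definition Qcurv (x : 'rV[R]_n) : R :=
  - laplacian Jcurv x - 2 * normsq_metric (schouten x) x
  + n%:R / 2 * Jcurv x ^+ 2.

(* nabla_X Y *)
Definition covderiv (X Y : 'rV[R]_n -> 'rV[R]_n) (x : 'rV[R]_n) : 'rV[R]_n :=
  \row_(k < n)
    (\sum_(i < n) X x 0 i * bderiv i (fun y => Y y 0 k) x
     + \sum_(i < n) \sum_(j < n) christoffel k i j x * X x 0 i * Y x 0 j).

Definition inner (x u v : 'rV[R]_n) : R :=
  \sum_(i < n) \sum_(j < n) G x i j * u 0 i * v 0 j.

Definition smooth_vfield (X : 'rV[R]_n -> 'rV[R]_n) : Prop :=
  forall k : 'I_n, smooth_cbal (fun x => X x 0 k).

Definition tangent_to_boundary (X : 'rV[R]_n -> 'rV[R]_n) : Prop :=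
  forall x, sphere x -> dot x (X x) = 0.

Definition normal_at (x nu : 'rV[R]_n) : Prop :=
  forall w, dot x w = 0 -> inner x nu w = 0.

(* The second fundamental form II(X, Y) = (nabla_X Y)^perp of the unit sphere
   vanishes identically. *)
Definition totally_geodesic_sphere : Prop :=
  forall X Y : 'rV[R]_n -> 'rV[R]_n,
    smooth_vfield X -> smooth_vfield Y ->
    tangent_to_boundary X -> tangent_to_boundary Y ->
    forall x, sphere x -> forall nu, normal_at x nu ->
      inner x (covderiv X Y x) nu = 0.

End Coordinates.

Section Hemisphere.
Context {R : realType} {n : nat}.

Definition height (p : 'rV[R]_(n + 1)) : R := p 0 (rshift n ord0).

Definition hemisphere : set 'rV[R]_(n + 1) :=
  [set p | dot p p = 1 /\ 0 <= height p].

Definition equator : set 'rV[R]_(n + 1) :=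
  [set p | dot p p = 1 /\ height p = 0].

Definition tangent (p u : 'rV[R]_(n + 1)) : Prop := dot p u = 0.

Definition tangent_equator (p u : 'rV[R]_(n + 1)) : Prop :=
  dot p u = 0 /\ height u = 0.

Definition stereo (x : 'rV[R]_n) : 'rV[R]_(n + 1) :=
  (1 + dot x x)^-1 *: row_mx (2 *: x) ((1 - dot x x)%:M : 'M[R]_1).

Definition chart (p : 'rV[R]_(n + 1)) : 'rV[R]_n :=
  (1 + height p)^-1 *: lsubmx p.

(* [g p u v] is meaningful only for [p] in the hemisphere and [u], [v] tangent
   to the sphere at [p]. *)
Definition tensor2 : Type :=
  'rV[R]_(n + 1) -> 'rV[R]_(n + 1) -> 'rV[R]_(n + 1) -> R.

Definition round : tensor2 := fun _ u v => dot u v.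

Definition components (g : tensor2) (x : 'rV[R]_n) : 'M[R]_n :=
  \matrix_(i, j) g (stereo x) ('D_(delta_mx 0 i) stereo x)
                              ('D_(delta_mx 0 j) stereo x).

Definition smooth_hemisphere (f : 'rV[R]_(n + 1) -> R) : Prop :=
  smooth_cbal (fun x : 'rV[R]_n => f (stereo x)).

Definition riemannian_metric (g : tensor2) : Prop :=
  [/\ forall p, hemisphere p -> forall a u v w,
        tangent p u -> tangent p v -> tangent p w ->
        g p (a *: u + v) w = a * g p u w + g p v w,
      forall p, hemisphere p -> forall u v,
        tangent p u -> tangent p v -> g p u v = g p v u,
      forall p, hemisphere p -> forall u,
        tangent p u -> u != 0 -> 0 < g p u u
    & forall i j : 'I_n, smooth_cbal (fun x => components g x i j)].

Definition conformal_to_round (g : tensor2) : Prop :=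
  exists phi : 'rV[R]_(n + 1) -> R,
    [/\ smooth_hemisphere phi,
        forall p, hemisphere p -> 0 < phi p
      & forall p, hemisphere p -> forall u v,
          tangent p u -> tangent p v -> g p u v = phi p * round p u v].

Definition scalar_curvature (g : tensor2) (p : 'rV[R]_(n + 1)) : R :=
  scalar_curv (components g) (chart p).

Definition Q_curvature (g : tensor2) (p : 'rV[R]_(n + 1)) : R :=
  Qcurv (components g) (chart p).

Definition totally_geodesic_boundary (g : tensor2) : Prop :=
  totally_geodesic_sphere (components g).

End Hemisphere.

Arguments tensor2 R n : clear implicits.

(* Main.v *)
Require Import Defs.
From HB Require Import structures.
From mathcomp Require Import all_boot all_order all_algebra.
From mathcomp Require Import all_classical all_reals all_analysis.
From mathcomp Require Import ring lra.
Set Implicit Arguments.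
Unset Strict Implicit.
Unset Printing Implicit Defensive.
Import Order.TTheory GRing.Theory Num.Theory.
Import numFieldNormedType.Exports.
Local Open Scope classical_set_scope.
Local Open Scope ring_scope.

(** Stereographic projection turns the hemisphere into the closed unit ball,
    where the round metric is [expR (2 tau0)] times the flat one, with
    [expR (- tau0) = qf = (1 + |x|^2) / 2], and a conformal metric [g] is
    [expR (2 tau)] times the flat one.  Put [k = (n - 4) / 2] and let [psi k] be
    the primitive of [expR (k t)] vanishing at [0].  The Paneitz operator is conformally
    covariant and its flat version is the bilaplacian, so that
    [lap (lap (psi k o tau)) = Q_g * expR ((k + 4) tau)] ([bilaplacian_psi]);
    working with [psi k] rather than with a power of the conformal factor
    treats the dimensions three, four and larger in the same way.

    Subtract the same identity for the round metric.  As [expR ((k + 4) t)] is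
    a convex function of [psi k t] ([psi_convex]), the inequality [Q_g >= Q_0]
    becomes linear in [V = psi k o tau - psi k o tau0]: it says that
    [lap (lap V)] is at least a positive constant times [expR (4 tau0) V].  On the
    sphere this is the Paneitz operator minus [(n + 4) / 2 * Q_0], which is
    the product of [- Laplacian - n] and [- Laplacian + (n^2 - 4) / 2]; in the
    ball, for the rescaled unknown [v = V / qf], the product takes the form of
    [paneitz_factor], with no first-order terms.

    The inequality is then integrated by maximum principles.  The boundary
    conditions give [v = 0] and, because the boundary is totally geodesic,
    zero radial derivative of [v]; the scalar curvature bound makes the first factor
    [eigen_op v] nonnegative on the boundary, hence everywhere since the other
    factor has a positive constant term ([eigen_op_v_ge0]).  So [v] is a
    supersolution at the first Dirichlet eigenvalue [n] of the hemisphere.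
    That value is critical, but [v] vanishes to second order at the boundary
    whereas the first eigenfunction (the height) vanishes to first order, and
    the comparison of the two gives [v >= 0] ([eigen_supersolution_ge0]).  Now
    [v] is superharmonic for the flat Laplacian, nonnegative, and its gradient
    is zero at every zero of [v], boundary zeros included; the Hopf boundary
    lemma forces [v = 0] ([superharmonic_eq0]).  Therefore [tau = tau0]. *)

(** * Smooth functions on open sets *)

Section SmoothOpen.
Context {R : realType}.

Lemma near_eq_differentiable (V W : normedModType R) (f g : V -> W) (a : V) :
  {near a, f =1 g} -> differentiable f a -> differentiable g a.
Proof.
move=> fg df.
have -> : g = f + (g - f) by rewrite addrC subrK.
apply: differentiableD => //.
have h0 : (g - f) \o shift a = cst ((g - f) a) + \0 +o_ 0 id.
  apply/eqaddoP => e e0.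
  have fg' : \forall y \near (0 : V), f (y + a) = g (y + a).
    by move/nbhs0P : fg; apply: filterS => y; rewrite addrC.
  near=> y.
  rewrite /= !fctE /=.
  rewrite (nbhs_singleton fg) (near fg' y)// !subrr addr0 subrr normr0.
  by rewrite mulr_ge0// ltW.
apply/diff_locallyP; have c0 : continuous (\0 : V -> W) by exact: cst_continuous.
rewrite (diff_unique c0 h0).
by split.
Unshelve. all: by end_near. Qed.

Section Dim.
Context {n : nat}.
Implicit Types (f g : 'rV[R]_n -> R) (U : set 'rV[R]_n).

(** Differentiability of all derivatives of order at most [k]. Grading
    [smooth_on] by the order makes its closure properties provable by
    induction. *)
Definition Ck k U f := forall s : seq 'I_n, (size s <= k)%N ->
  forall x, U x -> differentiable (pderivs s f) x.

Lemma smooth_onP U f : smooth_on U f <-> forall k, Ck k U f.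
Proof.
split=> [sf k s _|sf s]; first exact: sf.
exact: (sf (size s) s).
Qed.

Lemma Ck0P U f : Ck 0 U f <-> forall x, U x -> differentiable f x.
Proof.
split=> [sf x|sf s]; first exact: (sf [::]).
by rewrite leqn0 size_eq0 => /eqP ->.
Qed.

(** The innermost derivative is peeled off, so that the Leibniz and chain
    rules for first derivatives give the induction step for all orders. *)
Lemma CkSP k U f : Ck k.+1 U f <->
  (forall x, U x -> differentiable f x) /\ forall i, Ck k U (pderiv i f).
Proof.
split=> [sf|[df sf] s].
  split=> [|i s sk]; first exact: (sf [::]).
  have := sf (rcons s i).
  by rewrite size_rcons ltnS => /(_ sk); rewrite /pderivs foldr_rcons.
case/lastP: s => [_|s i]; first exact: df.
by rewrite size_rcons ltnS /pderivs foldr_rcons => sk; exact: sf.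
Qed.

Lemma CkW k U f : Ck k.+1 U f -> Ck k U f.
Proof. by move=> sf s sk; apply: sf; rewrite ltnW. Qed.

Lemma smooth_onS (U U' : set 'rV[R]_n) f :
  U `<=` U' -> smooth_on U' f -> smooth_on U f.
Proof. by move=> UU' sf s x /UU'; exact: sf. Qed.

Lemma smooth_on_diff U f x : smooth_on U f -> U x -> differentiable f x.
Proof. by move=> sf; exact: (sf [::]). Qed.

Lemma smooth_on_pderiv U f i : smooth_on U f -> smooth_on U (pderiv i f).
Proof.
by move=> /smooth_onP sf; apply/smooth_onP => k; have /CkSP[_] := sf k.+1.
Qed.

Lemma near_open U f g x : open U -> U x -> (forall y, U y -> f y = g y) ->
  {near x, f =1 g}.
Proof. by move=> oU Ux fg; apply: filterS (open_nbhs_nbhs (conj oU Ux)). Qed.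

Lemma pderiv_eq_on U f g i x : open U -> U x ->
  (forall y, U y -> f y = g y) -> pderiv i f x = pderiv i g x.
Proof. by move=> oU Ux fg; apply: near_eq_derive; exact: near_open fg. Qed.

Lemma Ck_eq k U f g : open U -> (forall y, U y -> f y = g y) ->
  Ck k U f -> Ck k U g.
Proof.
move=> oU; elim: k f g => [|k IH] f g fg.
  move=> /Ck0P sf; apply/Ck0P => x Ux.
  exact: near_eq_differentiable (near_open oU Ux fg) (sf _ Ux).
move=> /CkSP[df sf]; apply/CkSP; split=> [x Ux|i].
  exact: near_eq_differentiable (near_open oU Ux fg) (df _ Ux).
by apply: (IH (pderiv i f)) => // y Uy; exact: pderiv_eq_on fg.
Qed.

Lemma smooth_on_eq U f g : open U -> (forall y, U y -> f y = g y) ->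
  smooth_on U f -> smooth_on U g.
Proof.
by move=> oU fg /smooth_onP sf; apply/smooth_onP => k; exact: Ck_eq fg (sf k).
Qed.

Lemma pderivD f g i x : differentiable f x -> differentiable g x ->
  pderiv i (fun y => f y + g y) x = pderiv i f x + pderiv i g x.
Proof. by move=> df dg; apply: deriveD; exact: diff_derivable. Qed.

Lemma pderivM f g i x : differentiable f x -> differentiable g x ->
  pderiv i (fun y => f y * g y) x = pderiv i f x * g x + f x * pderiv i g x.
Proof.
move=> df dg; rewrite /pderiv deriveM; try exact: diff_derivable.
by rewrite addrC /GRing.scale /= mulrC.
Qed.

Lemma pderiv_comp (h : R -> R) (c : R) f i x : differentiable f x ->
  is_derive (f x) 1 h c ->
  pderiv i (fun y => h (f y)) x = c * pderiv i f x.
Proof.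
move=> df dh; have dh' : differentiable h (f x).
  by apply/derivable1_diffP; exact: ex_derive.
rewrite /pderiv deriveE; last exact: differentiable_comp.
rewrite diff_comp// /= -deriveE// -deriveE// -[X in 'D_X h _]mulr1.
rewrite deriveE// [LHS](linearZ _ _) -deriveE//.
by rewrite derive_val /GRing.scale /= mulrC.
Qed.

Lemma pderiv_cst (c : R) (i : 'I_n) x : pderiv i (fun=> c) x = 0.
Proof. exact: derive_cst. Qed.

Lemma coord_differentiable (j : 'I_n) (x : 'rV[R]_n) :
  differentiable (fun y : 'rV[R]_n => y 0 j) x.
Proof. exact: differentiable_coord. Qed.

Lemma pderiv_coord (j : 'I_n) i x :
  pderiv i (fun y : 'rV[R]_n => y 0 j) x = (i == j)%:R.
Proof.
rewrite /pderiv.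
have := @derive_mx R _ _ _ (@id 'rV[R]_n) x (delta_mx 0 i) (@derivable_id _ _ _ _).
by rewrite derive_id => /matrixP /(_ 0 j); rewrite !mxE eqxx /= => <-; rewrite eq_sym.
Qed.

Lemma CkD k U f g : open U -> Ck k U f -> Ck k U g ->
  Ck k U (fun y => f y + g y).
Proof.
move=> oU; elim: k f g => [|k IH] f g.
  move=> /Ck0P sf /Ck0P sg; apply/Ck0P => x Ux.
  exact: (differentiableD (sf _ Ux) (sg _ Ux)).
move=> /CkSP[df sf] /CkSP[dg sg]; apply/CkSP; split=> [x Ux|i].
  exact: (differentiableD (df _ Ux) (dg _ Ux)).
apply: (Ck_eq oU _ (IH _ _ (sf i) (sg i))) => y Uy.
by rewrite pderivD//; [exact: df|exact: dg].
Qed.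

Lemma CkM k U f g : open U -> Ck k U f -> Ck k U g ->
  Ck k U (fun y => f y * g y).
Proof.
move=> oU; elim: k f g => [|k IH] f g.
  move=> /Ck0P sf /Ck0P sg; apply/Ck0P => x Ux.
  exact: (differentiableM (sf _ Ux) (sg _ Ux)).
move=> cf cg.
have /CkSP[df sf] := cf; have /CkSP[dg sg] := cg; apply/CkSP; split=> [x Ux|i].
  exact: (differentiableM (df _ Ux) (dg _ Ux)).
apply: (Ck_eq oU _ (CkD oU (IH _ _ (sf i) (CkW cg)) (IH _ _ (CkW cf) (sg i)))).
by move=> y Uy; rewrite pderivM//; [exact: df|exact: dg].
Qed.

Lemma CkC k U (c : R) : Ck k U (fun=> c).
Proof.
elim: k c => [|k IH] c; first by apply/Ck0P => x _; exact: differentiable_cst.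
apply/CkSP; split=> [x _|i]; first exact: differentiable_cst.
have -> : pderiv i (fun=> c) = (fun=> 0) by apply/funext => x; exact: pderiv_cst.
exact: IH.
Qed.

Lemma Ck_coord k U j : Ck k U (fun y : 'rV[R]_n => y 0 j).
Proof.
case: k => [|k]; first by apply/Ck0P => x _; exact: coord_differentiable.
apply/CkSP; split=> [x _|i]; first exact: coord_differentiable.
have -> : pderiv i (fun y : 'rV[R]_n => y 0 j) = (fun=> (i == j)%:R).
  by apply/funext => x; exact: pderiv_coord.
exact: CkC.
Qed.

Lemma is_derive_diff1 (h : R -> R) (x c : R) : is_derive x 1 h c -> differentiable h x.
Proof. by move=> dh; apply/derivable1_diffP; exact: ex_derive. Qed.

Lemma Ck_expR k U f : open U -> Ck k U f -> Ck k U (fun y => expR (f y)).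
Proof.
move=> oU; have dexp x : differentiable (@expR R) x.
  exact: is_derive_diff1 (is_derive_expR x).
elim: k => [|k IH].
  move=> /Ck0P sf; apply/Ck0P => x Ux.
  exact: differentiable_comp (sf _ Ux) (dexp _).
move=> cf; have /CkSP[df sf] := cf; apply/CkSP; split=> [x Ux|i].
  exact: differentiable_comp (df _ Ux) (dexp _).
apply: (Ck_eq oU _ (CkM oU (IH (CkW cf)) (sf i))) => y Uy.
by rewrite (pderiv_comp i (df _ Uy) (is_derive_expR _)).
Qed.

Lemma is_derive_inv (x : R) : x != 0 -> is_derive x 1 GRing.inv (- (x ^- 2)).
Proof.
move=> x0; have := @is_deriveV R id x 1 1 x0 _.
by rewrite /GRing.scale /= mulr1; apply.
Qed.

Lemma Ck_inv k U f : open U -> (forall x, U x -> f x != 0) ->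
  Ck k U f -> Ck k U (fun y => (f y)^-1).
Proof.
move=> oU f0; have dinv x : U x -> differentiable (@GRing.inv R) (f x).
  by move=> Ux; exact: is_derive_diff1 (is_derive_inv (f0 _ Ux)).
elim: k => [|k IH].
  move=> /Ck0P sf; apply/Ck0P => x Ux.
  exact: differentiable_comp (sf _ Ux) (dinv _ Ux).
move=> cf; have /CkSP[df sf] := cf; apply/CkSP; split=> [x Ux|i].
  exact: differentiable_comp (df _ Ux) (dinv _ Ux).
have I := IH (CkW cf).
apply: (Ck_eq oU _ (CkM oU (CkM oU (@CkC k U (-1)) (CkM oU I I)) (sf i))) => y Uy.
rewrite (pderiv_comp i (df _ Uy) (is_derive_inv (f0 _ Uy))).
by rewrite mulN1r -invfM.
Qed.

Lemma Ck_ln k U f : open U -> (forall x, U x -> 0 < f x) ->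
  Ck k U f -> Ck k U (fun y => ln (f y)).
Proof.
move=> oU f0; have dln x : U x -> differentiable (@ln R) (f x).
  by move=> Ux; exact: is_derive_diff1 (is_derive1_ln (f0 _ Ux)).
case: k => [|k].
  move=> /Ck0P sf; apply/Ck0P => x Ux.
  exact: differentiable_comp (sf _ Ux) (dln _ Ux).
move=> cf; have /CkSP[df sf] := cf; apply/CkSP; split=> [x Ux|i].
  exact: differentiable_comp (df _ Ux) (dln _ Ux).
have I : Ck k U (fun y => (f y)^-1).
  by apply: (Ck_inv oU _ (CkW cf)) => x Ux; rewrite gt_eqF// f0.
apply: (Ck_eq oU _ (CkM oU I (sf i))) => y Uy.
by rewrite (pderiv_comp i (df _ Uy) (is_derive1_ln (f0 _ Uy))).
Qed.

End Dim.
End SmoothOpen.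

(** * Mixed derivatives, second-order minimum condition *)

Section Lines.
Context {R : realType} {n : nat}.
Implicit Types (f g : 'rV[R]_n -> R) (U : set 'rV[R]_n) (x y v : 'rV[R]_n).

Lemma is_derive_line f x v (t : R) : differentiable f (x + t *: v) ->
  is_derive t 1 (fun s : R => f (x + s *: v)) ('D_v f (x + t *: v)).
Proof.
move=> df.
have E : (fun h : R => h^-1 *: (((fun s : R => f (x + s *: v)) \o shift t) (h *: (1 : R))
             - f (x + t *: v))) =
    (fun h : R => h^-1 *: ((f \o shift (x + t *: v)) (h *: v) - f (x + t *: v))).
  apply/funext => h /=; congr (_ *: (f _ - _)).
  by rewrite /GRing.scale /= mulr1 -/(GRing.scale _ _) scalerDl addrCA addrA [_ + x]addrC.
have dv := @diff_derivable R _ _ f _ v df.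
apply: DeriveDef; first by rewrite /derivable E.
by rewrite /derive E.
Qed.

Lemma derive_translate f x v a :
  'D_v (fun z => f (z + a)) x = 'D_v f (x + a).
Proof.
rewrite /derive.
have -> : (fun h : R => h^-1 *: (((fun z => f (z + a)) \o shift x) (h *: v) - f (x + a))) =
    (fun h : R => h^-1 *: ((f \o shift (x + a)) (h *: v) - f (x + a))).
  by apply/funext => h /=; rewrite addrA.
by [].
Qed.

Lemma line_continuous f x v (a b : R) :
  (forall t, t \in `[a, b] -> differentiable f (x + t *: v)) ->
  {within `[a, b], continuous (fun s : R => f (x + s *: v))}.
Proof.
move=> df; apply: derivable_within_continuous => t tab.
by have /is_derive_line[] := df t tab.
Qed.

Lemma line_MVT f x v (h : R) : 0 < h ->
  (forall t, t \in `[0, h] -> differentiable f (x + t *: v)) ->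
  exists2 t, t \in `[0, h] & f (x + h *: v) - f x = h * 'D_v f (x + t *: v).
Proof.
move=> h0 df.
have [t tI E] : exists2 t, t \in `]0, h[ & f (x + h *: v) - f (x + 0 *: v) =
    'D_v f (x + t *: v) * (h - 0).
  apply: (@MVT R (fun s => f (x + s *: v)) (fun t => 'D_v f (x + t *: v)) 0 h h0).
    move=> t tI; apply: is_derive_line; apply: df.
    by move: tI; apply: subset_itv_oo_cc.
  exact: line_continuous.
exists t; first by move: tI; apply: subset_itv_oo_cc.
by move: E; rewrite scale0r addr0 subr0 => ->; rewrite mulrC.
Qed.

Local Notation e i := (delta_mx 0 i : 'rV[R]_n).

Lemma subrBACA (a b c d : R) : a - b - (c - d) = a - c - (b - d).
Proof. ring. Qed.

(** The mean value theorem along [e j] applied to [f (y + h e_i) - f y], then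
    along [e i] to the [j]-th derivative. The case [i = j] is the second
    difference that detects minima. *)
Lemma mixed_difference f i j x (h : R) : 0 < h ->
  (forall s t, s \in `[0, h] -> t \in `[0, h] ->
     differentiable f (x + s *: e i + t *: e j) /\
     differentiable (pderiv j f) (x + s *: e i + t *: e j)) ->
  exists s t, [/\ s \in `[0, h], t \in `[0, h] &
    f (x + h *: e i + h *: e j) - f (x + h *: e i) - (f (x + h *: e j) - f x)
    = h ^+ 2 * pderiv i (pderiv j f) (x + s *: e i + t *: e j)].
Proof.
move=> h0 df.
have hI : h \in `[0, h] by rewrite in_itv /= lexx ltW.
have oI : 0 \in `[0, h] by rewrite in_itv /= lexx ltW.
pose F y := f (y + h *: e i) - f y.
have dsh y : differentiable f (y + h *: e i) ->
    differentiable (fun z => f (z + h *: e i)) y.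
  move=> d; apply: (@differentiable_comp _ _ _ _ (fun z => z + h *: e i) f) => //.
have dF t : t \in `[0, h] -> differentiable F (x + t *: e j).
  move=> tI; apply: (@differentiableB _ _ _ (fun z => f (z + h *: e i)) f).
    by apply: dsh; rewrite addrAC; apply df.
  by have := (df 0 t oI tI).1; rewrite scale0r addr0.
have [t tI E] := @line_MVT F x (e j) h h0 dF.
pose x' := x + t *: e j.
have dG s : s \in `[0, h] -> differentiable (pderiv j f) (x' + s *: e i).
  by move=> sI; rewrite /x' addrAC; apply df.
have [s sI E'] := @line_MVT (pderiv j f) x' (e i) h h0 dG.
exists s, t; split; [exact: sI|exact: tI|].
rewrite (addrAC x (h *: e i)).
have -> : f (x + h *: e j + h *: e i) - f (x + h *: e i) - (f (x + h *: e j) - f x)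
    = F (x + h *: e j) - F x.
  by rewrite /F; exact: subrBACA.
rewrite E [x + s *: _ + _]addrAC -/x'.
suff -> : 'D_(e j) F x' = pderiv j f (x' + h *: e i) - pderiv j f x'.
  by rewrite E' mulrA -expr2.
have d1 : differentiable f (x' + h *: e i) by rewrite /x' addrAC; apply df.
have d2 : differentiable f x'.
  by have := (df 0 t oI tI).1; rewrite scale0r addr0.
rewrite /F (@deriveB _ _ _ (fun z => f (z + h *: e i)) f); last 2 first.
- exact/diff_derivable/dsh.
- exact/diff_derivable.
by rewrite derive_translate.
Qed.

Lemma box_ball x i j (r : R) : 0 < r -> exists2 h : R, 0 < h &
  forall s t, `|s| <= h -> `|t| <= h -> ball x r (x + s *: e i + t *: e j).
Proof.
move=> r0.
have N0 : 0 < `|e i| + `|e j| + 1 by rewrite ltr_wpDl// addr_ge0.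
exists (r / (`|e i| + `|e j| + 1)); first by rewrite divr_gt0.
move=> s t sh th; rewrite -ball_normE /ball_ /= -addrA opprD addNKr normrN.
apply: le_lt_trans (ler_normD _ _) _; rewrite !normrZ.
set h := r / _ in sh th.
have : `|s| * `|e i| + `|t| * `|e j| <= h * (`|e i| + `|e j|).
  by rewrite mulrDr lerD// ler_wpM2r.
move=> /le_lt_trans; apply.
have -> : r = h * (`|e i| + `|e j| + 1) by rewrite /h divfK// gt_eqF.
by rewrite ltr_pM2l ?divr_gt0// ltrDl.
Qed.

Lemma near_gtr (f : 'rV[R]_n -> R) x c : {for x, continuous f} -> c < f x ->
  \forall y \near x, c < f y.
Proof. by move=> cf cfx; exact: (cvgr_gt _ cf). Qed.

Lemma near_ltr (f : 'rV[R]_n -> R) x c : {for x, continuous f} -> f x < c ->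
  \forall y \near x, f y < c.
Proof. by move=> cf cfx; exact: (cvgr_lt _ cf). Qed.

Lemma smooth_on_continuous U f x : smooth_on U f -> U x -> {for x, continuous f}.
Proof. by move=> sf Ux; exact/differentiable_continuous/smooth_on_diff/Ux. Qed.

(** If the inequality failed, a constant would separate the two mixed
    derivatives on a neighbourhood of [x], although both give the value of the
    same second difference at nearby points. *)
Lemma pderiv_sym_le U f i j x : open U -> U x -> smooth_on U f ->
  pderiv i (pderiv j f) x <= pderiv j (pderiv i f) x.
Proof.
move=> oU Ux sf; rewrite leNgt; apply/negP => lt.
set A := pderiv i (pderiv j f) in lt *; set B := pderiv j (pderiv i f) in lt *.
pose c := (A x + B x) / 2.
have cA : c < A x by rewrite /c; lra.
have cB : B x < c by rewrite /c; lra.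
have contA : {for x, continuous A} by apply: (@smooth_on_continuous U) => //; do 2 apply: smooth_on_pderiv.
have contB : {for x, continuous B} by apply: (@smooth_on_continuous U) => //; do 2 apply: smooth_on_pderiv.
have near1 : \forall y \near x, [/\ U y, c < A y & B y < c].
  near=> y; split; near: y.
  - exact: open_nbhs_nbhs.
  - exact: near_gtr.
  - exact: near_ltr.
have /nbhs_ballP[r /= r0 br] := near1.
have [h h0 bh] := @box_ball x i j r r0.
have box s t : s \in `[0, h] -> t \in `[0, h] ->
    [/\ U (x + s *: e i + t *: e j), c < A (x + s *: e i + t *: e j)
      & B (x + s *: e i + t *: e j) < c].
  rewrite !in_itv /= => /andP[s0 sh] /andP[t0 th]; apply: br; apply: bh.
    by rewrite ger0_norm.
  by rewrite ger0_norm.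
have box0 s t : s \in `[0, h] -> t \in `[0, h] ->
    differentiable f (x + s *: e i + t *: e j) /\
    differentiable (pderiv j f) (x + s *: e i + t *: e j).
  move=> sI' tI'; have [u _ _] := box s t sI' tI'.
  by split; [exact: smooth_on_diff u|exact: (smooth_on_diff (@smooth_on_pderiv _ _ _ _ j sf) u)].
have [s [t [sI tI E1]]] := @mixed_difference f i j x h h0 box0.
have box' u w : u \in `[0, h] -> w \in `[0, h] ->
    differentiable f (x + u *: e j + w *: e i) /\
    differentiable (pderiv i f) (x + u *: e j + w *: e i).
  move=> sI' tI'; rewrite addrAC; have [Uu _ _] := box w u tI' sI'.
  by split; [exact: smooth_on_diff Uu|exact: (smooth_on_diff (@smooth_on_pderiv _ _ _ _ i sf) Uu)].
have [s' [t' [sI' tI' E2]]] := @mixed_difference f j i x h h0 box'.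
have [_ A1 _] := box s t sI tI.
have [_ _] := box t' s' tI' sI'; rewrite addrAC => B1.
have : h ^+ 2 * A (x + s *: e i + t *: e j) = h ^+ 2 * B (x + s' *: e j + t' *: e i).
  apply: (etrans (esym E1)); apply: (etrans _ E2).
  by rewrite (addrAC x (h *: e j)); exact: subrBACA.
move/(mulfI _) => H; have {}H := H (lt0r_neq0 (exprn_gt0 2 h0)).
by have := lt_trans A1 (eq_ind_r (fun z => z < c) B1 H); rewrite ltxx.
Unshelve. all: by end_near. Qed.

Lemma pderiv_sym U f i j x : open U -> U x -> smooth_on U f ->
  pderiv i (pderiv j f) x = pderiv j (pderiv i f) x.
Proof.
move=> oU Ux sf; apply/eqP.
rewrite eq_le; apply/andP; split.
  exact: (pderiv_sym_le i j oU Ux sf).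
exact: (pderiv_sym_le j i oU Ux sf).
Qed.

Lemma second_diff_ge0 (a b c : R) :
  b <= a -> b <= c -> a - b - (b - c) < 0 -> False.
Proof. lra. Qed.

(** The second difference centred at the minimum is nonnegative. *)
Lemma pderiv2_min U f i x : open U -> U x -> smooth_on U f ->
  (\forall y \near x, f x <= f y) -> 0 <= pderiv i (pderiv i f) x.
Proof.
move=> oU Ux sf mf; rewrite leNgt; apply/negP => lt.
set A := pderiv i (pderiv i f) in lt *.
have contA : {for x, continuous A} by apply: (@smooth_on_continuous U) => //; do 2 apply: smooth_on_pderiv.
have near1 : \forall y \near x, [/\ U y, f x <= f y & A y < 0].
  near=> y; split; near: y.
  - exact: open_nbhs_nbhs.
  - exact: mf.
  - exact: near_ltr.
have /nbhs_ballP[r /= r0 br] := near1.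
have [h h0 bh] := @box_ball x i i r r0.
pose y := x - h *: e i.
have box s t : s \in `[0, h] -> t \in `[0, h] ->
    [/\ U (y + s *: e i + t *: e i), f x <= f (y + s *: e i + t *: e i)
      & A (y + s *: e i + t *: e i) < 0].
  rewrite !in_itv /= => /andP[s0 sh] /andP[t0 th]; apply: br.
  have -> : y + s *: e i + t *: e i = x + (s - h) *: e i + t *: e i.
    by rewrite /y scalerBl -(addrA x) [- _ + _]addrC.
  apply: bh; last by rewrite ger0_norm.
  by rewrite ler0_norm ?subr_le0// opprB gerBl.
have box' s t : s \in `[0, h] -> t \in `[0, h] ->
    differentiable f (y + s *: e i + t *: e i) /\
    differentiable (pderiv i f) (y + s *: e i + t *: e i).
  move=> sI tI; have [u _ _] := box s t sI tI.
  by split; [exact: smooth_on_diff u|exact: (smooth_on_diff (@smooth_on_pderiv _ _ _ _ i sf) u)].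
have [s [t [sI tI E]]] := @mixed_difference f i i y h h0 box'.
have hI : h \in `[0, h] by rewrite in_itv /= lexx ltW.
have oI : 0 \in `[0, h] by rewrite in_itv /= lexx ltW.
have [_ m1 _] := box h h hI hI.
have [_] := box 0 0 oI oI; rewrite scale0r !addr0 => m2 _.
have [_ _ m3] := box s t sI tI.
have yx : y + h *: e i = x by rewrite /y subrK.
move: E; rewrite -/A yx => E.
have : h ^+ 2 * A (y + s *: e i + t *: e i) < 0 by rewrite pmulr_rlt0// exprn_gt0.
rewrite -E; move: m1 m2; rewrite yx.
exact: second_diff_ge0.
Unshelve. all: by end_near. Qed.

Lemma derive_ge0_right f x v : differentiable f x ->
  (\forall t \near (0 : R)^'+, f x <= f (x + t *: v)) -> 0 <= 'D_v f x.
Proof.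
move=> df fx.
have /cvg_ex[l fl] := @diff_derivable _ _ _ f x v df.
have Dl : 'D_v f x = l by exact: (cvg_lim _ fl).
have fl' := cvg_dnbhs_at_right fl.
rewrite Dl -(cvg_lim _ fl')//.
apply: limr_ge; first by apply/cvg_ex; exists l.
near=> t.
rewrite /GRing.scale /= mulr_ge0//.
  rewrite invr_ge0 ltW//; near: t; exact: nbhs_right_gt.
by rewrite subr_ge0 addrC; near: t.
Unshelve. all: by end_near. Qed.

Lemma deriveE_pderiv f x v : differentiable f x ->
  'D_v f x = \sum_i v 0 i * pderiv i f x.
Proof.
move=> df; rewrite deriveE// [in LHS](row_sum_delta v) linear_sum.
by apply: eq_bigr => i _; rewrite [LHS]linearZ /pderiv deriveE.
Qed.

End Lines.

(** * Smooth functions on the closed ball *)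

Section Ball.
Context {R : realType} {n : nat}.
Implicit Types (f g : 'rV[R]_n -> R) (U : set 'rV[R]_n) (x y v : 'rV[R]_n).

Lemma Ck_sum k U (I : Type) (r : seq I) (F : I -> 'rV[R]_n -> R) : open U ->
  (forall i, Ck k U (F i)) -> Ck k U (fun y => \sum_(i <- r) F i y).
Proof.
move=> oU cF; elim: r => [|a r IH].
  by apply: (Ck_eq oU _ (@CkC _ _ k U 0)) => y _; rewrite big_nil.
by apply: (Ck_eq oU _ (CkD oU (cF a) IH)) => y _; rewrite big_cons.
Qed.

Lemma smooth_dot (U : set 'rV[R]_n) : open U -> smooth_on U (fun y => dot y y).
Proof.
move=> oU; apply/smooth_onP => k.
apply: (Ck_sum (index_enum _) oU) => i; apply: (CkM oU); exact: Ck_coord.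
Qed.

Lemma dot_continuous : continuous (fun y : 'rV[R]_n => dot y y).
Proof.
by move=> x; exact: (@smooth_on_continuous _ _ setT _ _ (smooth_dot openT)).
Qed.

Lemma obal_open : open (@obal R n).
Proof.
rewrite (_ : @obal R n = (fun y => dot y y) @^-1` [set t | t < 1])//.
apply: open_comp; last exact: open_lt.
by move=> x _; exact: dot_continuous.
Qed.

Lemma cbal_closed : closed (@cbal R n).
Proof.
rewrite (_ : @cbal R n = (fun y => dot y y) @^-1` [set t | t <= 1])//.
apply: preimage_closed; last exact: closed_le.
by move=> x _; exact: dot_continuous.
Qed.

Lemma dotZ (a : R) x : dot (a *: x) (a *: x) = a ^+ 2 * dot x x.
Proof. by rewrite /dot mulr_sumr; apply: eq_bigr => i _; rewrite !mxE; ring. Qed.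

Lemma dot_ge0 x : 0 <= dot x x.
Proof. by apply: sumr_ge0 => i _; rewrite -expr2 sqr_ge0. Qed.

Lemma dot_eq0 x : (dot x x == 0) = (x == 0).
Proof.
rewrite /dot psumr_eq0; last by move=> i _; rewrite -expr2 sqr_ge0.
apply/allP/eqP => [H|-> i _]; last by rewrite mxE mul0r eqxx.
apply/rowP => i; rewrite mxE; apply/eqP.
by have := H i (mem_index_enum _); rewrite mulf_eq0 orbb.
Qed.

Lemma obalW x : obal x -> cbal x.
Proof. exact: ltW. Qed.

Lemma cbal_obal_sphere x : cbal x -> obal x \/ sphere x.
Proof. by rewrite /cbal /obal /sphere /= le_eqVlt => /orP[/eqP|]; [right|left]. Qed.

(** Makes the limits defining [bderiv] meaningful at boundary points: radial
    contraction moves every point of the closed ball inside. *)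
Lemma obal_proper x : cbal x -> ProperFilter (within (@obal R n) (nbhs x)).
Proof.
move=> bx; apply: Build_ProperFilter_ex => P.
rewrite /within /= => /nbhs_ballP[r /= r0 rP].
suff [y xy oy] : exists2 y, ball x r y & obal y by exists y; exact: rP.
pose t := Num.min (1 / 2) (r / (2 * (`|x| + 1))) : R.
have x1 : 0 < 2 * (`|x| + 1) by rewrite mulr_gt0// ltr_wpDl.
have t0 : 0 < t by rewrite lt_min divr_gt0//= divr_gt0.
have t1 : t <= 1 / 2 by rewrite ge_min lexx.
have tr : t <= r / (2 * (`|x| + 1)) by rewrite ge_min lexx orbT.
exists ((1 - t) *: x).
  rewrite -ball_normE /ball_ /= scalerBl scale1r opprB addrCA subrr addr0.
  rewrite normrZ gtr0_norm//.
  have : t * `|x| <= r / (2 * (`|x| + 1)) * `|x| by rewrite ler_wpM2r.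
  move=> /le_lt_trans; apply.
  rewrite mulrAC ltr_pdivrMr// ltr_pM2l//.
  by have := normr_ge0 x; lra.
rewrite /obal /= dotZ.
have : (1 - t) ^+ 2 * dot x x <= (1 - t) ^+ 2 by rewrite ler_piMr// sqr_ge0.
move=> /le_lt_trans; apply; clear -t0 t1; nra.
Qed.

Lemma smooth_cbal_pair f g x : smooth_cbal f -> smooth_cbal g -> cbal x ->
  exists U F G, [/\ open U, U x, smooth_on U F /\ smooth_on U G,
    forall y, U y -> cbal y -> F y = f y & forall y, U y -> cbal y -> G y = g y].
Proof.
move=> sf sg bx.
have [U [F [[oU Ux] sF eF]]] := sf x bx.
have [V [G [[oV Vx] sG eG]]] := sg x bx.
exists (U `&` V), F, G; split.
- exact: openI.
- by [].
- by split; [apply: smooth_onS sF|apply: smooth_onS sG] => y [].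
- by move=> y [Uy _]; exact: eF.
- by move=> y [_ Vy]; exact: eG.
Qed.

(** Near [x] and inside the open ball the derivatives of [f] and of its
    extension agree, and those of the extension are continuous. All rules of
    calculus for [bderiv], at boundary points too, are read off from local
    extensions. *)
Lemma bderiv_ext U F f i x : open U -> U x -> smooth_on U F ->
  (forall y, U y -> cbal y -> F y = f y) -> cbal x ->
  bderiv i f x = pderiv i F x.
Proof.
move=> oU Ux sF eF bx; have PF := obal_proper bx.
apply: cvg_lim => //.
have cF : {for x, continuous (pderiv i F)}.
  by apply: smooth_on_continuous Ux; exact: smooth_on_pderiv.
have : pderiv i F y @[y --> within (@obal R n) (nbhs x)] --> pderiv i F x.
  by apply: cvg_trans cF; apply: cvg_app; exact: cvg_within.
apply: cvg_trans; apply: near_eq_cvg.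
near=> y.
have Uy : U y by near: y; apply: cvg_within; exact: open_nbhs_nbhs.
have oy : obal y by near: y; exact: withinT.
apply: (pderiv_eq_on i (openI oU obal_open) (conj Uy oy)).
by move=> z [Uz oz]; apply: eF => //; exact: obalW.
Unshelve. all: by end_near. Qed.

(** The definition of [bderiv] sees only interior points, so equality on the
    closed ball suffices; this is what allows rewriting under nested
    derivatives. *)
Lemma bderiv_eq f g i x : (forall y, cbal y -> f y = g y) ->
  bderiv i f x = bderiv i g x.
Proof.
move=> fg; rewrite /bderiv; congr (lim _).
have E : {near within (@obal R n) (nbhs x), pderiv i f =1 pderiv i g}.
  near=> y.
  have oy : obal y by near: y; exact: withinT.
  by apply: (pderiv_eq_on i obal_open oy) => z /obalW; exact: fg.
rewrite eqEsubset; split; apply: near_eq_cvg => //.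
by apply: filterS E => y.
Unshelve. all: by end_near. Qed.

End Ball.

(** [bderiv] as a constant without reduction behaviour, known from here on
    through the rules of calculus only. *)
HB.lock Definition bd (R : realType) (n : nat) (i : 'I_n) (f : 'rV[R]_n -> R) :
  'rV[R]_n -> R := bderiv i f.

Section BallDerivatives.
Context {R : realType} {n : nat}.
Implicit Types (f g : 'rV[R]_n -> R) (U : set 'rV[R]_n) (x y v : 'rV[R]_n).

Lemma bdE i f : bderiv i f = bd i f.
Proof. by rewrite bd.unlock. Qed.

Lemma bd_ext U F f i x : open U -> U x -> smooth_on U F ->
  (forall y, U y -> cbal y -> F y = f y) -> cbal x ->
  bd i f x = pderiv i F x.
Proof. by rewrite -bdE; exact: bderiv_ext. Qed.

Lemma bd_eq f g i x : (forall y, cbal y -> f y = g y) -> bd i f x = bd i g x.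
Proof. by rewrite -!bdE; exact: bderiv_eq. Qed.

Lemma smooth_cbal_eq f g : (forall y, cbal y -> f y = g y) ->
  smooth_cbal f -> smooth_cbal g.
Proof.
move=> fg sf x bx; have [U [F [oU sF eF]]] := sf x bx.
by exists U, F; split => // y Uy By; rewrite eF// fg.
Qed.

Lemma smooth_onT f : smooth_on setT f -> smooth_cbal f.
Proof.
by move=> sf x _; exists setT, f; split => //; split => //; exact: openT.
Qed.

Lemma smooth_cbalC (c : R) : smooth_cbal (fun _ : 'rV[R]_n => c).
Proof. by apply: smooth_onT; apply/smooth_onP => k; exact: CkC. Qed.

Lemma smooth_cbal_coord j : smooth_cbal (fun y : 'rV[R]_n => y 0 j).
Proof. by apply: smooth_onT; apply/smooth_onP => k; exact: Ck_coord. Qed.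

Lemma smooth_cbalD f g : smooth_cbal f -> smooth_cbal g ->
  smooth_cbal (fun y => f y + g y).
Proof.
move=> sf sg x bx.
have [U [F [G [oU Ux [sF sG] eF eG]]]] := smooth_cbal_pair sf sg bx.
exists U, (fun y => F y + G y); split => [//||y Uy By]; last by rewrite eF// eG.
apply/smooth_onP => k; apply: (CkD oU); exact: (smooth_onP _ _).1.
Qed.

Lemma smooth_cbalM f g : smooth_cbal f -> smooth_cbal g ->
  smooth_cbal (fun y => f y * g y).
Proof.
move=> sf sg x bx.
have [U [F [G [oU Ux [sF sG] eF eG]]]] := smooth_cbal_pair sf sg bx.
exists U, (fun y => F y * G y); split => [//||y Uy By]; last by rewrite eF// eG.
apply/smooth_onP => k; apply: (CkM oU); exact: (smooth_onP _ _).1.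
Qed.

Lemma smooth_cbal_sum (I : Type) (r : seq I) (F : I -> 'rV[R]_n -> R) :
  (forall i, smooth_cbal (F i)) -> smooth_cbal (fun y => \sum_(i <- r) F i y).
Proof.
move=> sF; elim: r => [|a r IH].
  by apply: smooth_cbal_eq (smooth_cbalC 0) => y _; rewrite big_nil.
by apply: smooth_cbal_eq (smooth_cbalD (sF a) IH) => y _; rewrite big_cons.
Qed.

Lemma smooth_cbal_expR f : smooth_cbal f -> smooth_cbal (fun y => expR (f y)).
Proof.
move=> sf x bx; have [U [F [[oU Ux] sF eF]]] := sf x bx.
exists U, (fun y => expR (F y)); split => [//||y Uy By]; last by rewrite eF.
by apply/smooth_onP => k; apply: (Ck_expR oU); exact: (smooth_onP _ _).1.
Qed.

Lemma smooth_cbal_pos f x : smooth_cbal f -> cbal x -> 0 < f x ->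
  exists U F, [/\ open U, U x, smooth_on U F, forall y, U y -> 0 < F y &
    forall y, U y -> cbal y -> F y = f y].
Proof.
move=> sf bx fx; have [U [F [[oU Ux] sF eF]]] := sf x bx.
have cF : {for x, continuous F} by exact: smooth_on_continuous Ux.
have : nbhs x [set y | 0 < F y] by apply: near_gtr => //; rewrite eF.
rewrite nbhsE /= => -[V [oV Vx] VF].
exists (U `&` V), F; split.
- exact: openI.
- by [].
- by apply: smooth_onS sF => y [].
- by move=> y [_ /VF].
- by move=> y [Uy _]; exact: eF.
Qed.

Lemma smooth_cbal_ln f : smooth_cbal f -> (forall x, cbal x -> 0 < f x) ->
  smooth_cbal (fun y => ln (f y)).
Proof.
move=> sf f0 x bx; have [U [F [oU Ux sF F0 eF]]] := smooth_cbal_pos sf bx (f0 x bx).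
exists U, (fun y => ln (F y)); split => [//||y Uy By]; last by rewrite eF.
by apply/smooth_onP => k; apply: (Ck_ln oU) => //; exact: (smooth_onP _ _).1.
Qed.

Lemma smooth_cbal_bd f i : smooth_cbal f -> smooth_cbal (bd i f).
Proof.
move=> sf x bx; have [U [F [[oU Ux] sF eF]]] := sf x bx.
exists U, (pderiv i F); split => [//||y Uy By]; first exact: smooth_on_pderiv.
by rewrite (bd_ext i oU Uy sF eF By).
Qed.

Lemma bdC (c : R) i x : cbal x -> bd i (fun=> c) x = 0.
Proof.
move=> bx; have sc : smooth_on setT (fun _ : 'rV[R]_n => c).
  by apply/smooth_onP => k; exact: CkC.
by rewrite (bd_ext i openT I sc (fun _ _ _ => erefl) bx) pderiv_cst.
Qed.

Lemma bd_coord j i x : cbal x ->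
  bd i (fun y : 'rV[R]_n => y 0 j) x = (i == j)%:R.
Proof.
move=> bx; have sc : smooth_on setT (fun y : 'rV[R]_n => y 0 j).
  by apply/smooth_onP => k; exact: Ck_coord.
by rewrite (bd_ext i openT I sc (fun _ _ _ => erefl) bx) pderiv_coord.
Qed.

Lemma bdD f g i x : smooth_cbal f -> smooth_cbal g -> cbal x ->
  bd i (fun y => f y + g y) x = bd i f x + bd i g x.
Proof.
move=> sf sg bx.
have [U [F [G [oU Ux [sF sG] eF eG]]]] := smooth_cbal_pair sf sg bx.
rewrite (bd_ext i oU Ux sF eF bx) (bd_ext i oU Ux sG eG bx).
rewrite -pderivD; [|exact: smooth_on_diff sF Ux|exact: smooth_on_diff sG Ux].
apply: (bd_ext i oU Ux _ _ bx).
  by apply/smooth_onP => k; apply: (CkD oU); exact: (smooth_onP _ _).1.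
by move=> y Uy By; rewrite eF// eG.
Qed.

Lemma bdM f g i x : smooth_cbal f -> smooth_cbal g -> cbal x ->
  bd i (fun y => f y * g y) x = bd i f x * g x + f x * bd i g x.
Proof.
move=> sf sg bx.
have [U [F [G [oU Ux [sF sG] eF eG]]]] := smooth_cbal_pair sf sg bx.
rewrite (bd_ext i oU Ux sF eF bx) (bd_ext i oU Ux sG eG bx) -eF// -eG//.
rewrite -pderivM; [|exact: smooth_on_diff sF Ux|exact: smooth_on_diff sG Ux].
apply: (bd_ext i oU Ux _ _ bx).
  by apply/smooth_onP => k; apply: (CkM oU); exact: (smooth_onP _ _).1.
by move=> y Uy By; rewrite eF// eG.
Qed.

Lemma bdZ (c : R) f i x : smooth_cbal f -> cbal x ->
  bd i (fun y => c * f y) x = c * bd i f x.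
Proof.
move=> sf bx.
by rewrite (bdM i (smooth_cbalC c) sf bx) bdC// mul0r add0r.
Qed.

Lemma smooth_cbalZ (c : R) f : smooth_cbal f -> smooth_cbal (fun y => c * f y).
Proof. by move=> sf; exact: (smooth_cbalM (smooth_cbalC c) sf). Qed.

Lemma smooth_cbalN f : smooth_cbal f -> smooth_cbal (fun y => - f y).
Proof.
by move=> sf; apply: smooth_cbal_eq (smooth_cbalZ (-1) sf) => y _; rewrite mulN1r.
Qed.

Lemma bdN f i x : smooth_cbal f -> cbal x ->
  bd i (fun y => - f y) x = - bd i f x.
Proof.
move=> sf bx; rewrite -mulN1r -(bdZ (-1) i sf bx).
by apply: bd_eq => y _; rewrite mulN1r.
Qed.

Lemma smooth_cbalB f g : smooth_cbal f -> smooth_cbal g ->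
  smooth_cbal (fun y => f y - g y).
Proof. by move=> sf sg; exact: (smooth_cbalD sf (smooth_cbalN sg)). Qed.

Lemma bdB f g i x : smooth_cbal f -> smooth_cbal g -> cbal x ->
  bd i (fun y => f y - g y) x = bd i f x - bd i g x.
Proof.
move=> sf sg bx; rewrite -(bdN i sg bx).
exact: (bdD i sf (smooth_cbalN sg) bx).
Qed.

Lemma bd_sum (I : Type) (r : seq I) (F : I -> 'rV[R]_n -> R) i x :
  (forall j, smooth_cbal (F j)) -> cbal x ->
  bd i (fun y => \sum_(j <- r) F j y) x = \sum_(j <- r) bd i (F j) x.
Proof.
move=> sF bx; elim: r => [|a r IH].
  rewrite big_nil; apply: etrans (bdC 0 i bx).
  by apply: bd_eq => y _; rewrite big_nil.
rewrite big_cons -IH -(bdD i (sF a) (smooth_cbal_sum _ sF) bx).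
by apply: bd_eq => y _; rewrite big_cons.
Qed.

Lemma bd_expR f i x : smooth_cbal f -> cbal x ->
  bd i (fun y => expR (f y)) x = expR (f x) * bd i f x.
Proof.
move=> sf bx; have [U [F [[oU Ux] sF eF]]] := sf x bx.
rewrite (bd_ext i oU Ux sF eF bx) -eF//.
rewrite -(pderiv_comp i (smooth_on_diff sF Ux) (is_derive_expR _)).
apply: (bd_ext i oU Ux _ _ bx).
  by apply/smooth_onP => k; apply: (Ck_expR oU); exact: (smooth_onP _ _).1.
by move=> y Uy By; rewrite eF.
Qed.

Lemma bd_sym f i j x : smooth_cbal f -> cbal x ->
  bd i (bd j f) x = bd j (bd i f) x.
Proof.
move=> sf bx; have [U [F [[oU Ux] sF eF]]] := sf x bx.
have E k : forall y, U y -> cbal y -> pderiv k F y = bd k f y.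
  by move=> y Uy By; rewrite (bd_ext k oU Uy sF eF By).
rewrite (bd_ext i oU Ux (smooth_on_pderiv _ sF) (E j) bx).
rewrite (bd_ext j oU Ux (smooth_on_pderiv _ sF) (E i) bx).
exact: pderiv_sym oU Ux sF.
Qed.

Lemma smooth_cbal_interior f x : smooth_cbal f -> obal x ->
  exists2 U, open U /\ U x & smooth_on U f /\ U `<=` @obal R n.
Proof.
move=> sf ox; have [U [F [[oU Ux] sF eF]]] := sf x (obalW ox).
have oUo : open (U `&` @obal R n) by exact: openI obal_open.
exists (U `&` @obal R n) => //; split; last by move=> y [].
apply: (smooth_on_eq (f := F)) => //.
  by move=> y [Uy oy]; apply: eF => //; exact: obalW.
by apply: smooth_onS sF => y [].
Qed.

Lemma bd2_min f i x : smooth_cbal f -> obal x ->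
  (\forall y \near x, f x <= f y) -> 0 <= bd i (bd i f) x.
Proof.
move=> sf ox fm; have [U [oU Ux] [sU Uo]] := smooth_cbal_interior sf ox.
have E k : forall y, U y -> cbal y -> pderiv k f y = bd k f y.
  by move=> y Uy By; rewrite (@bd_ext U f).
rewrite (bd_ext i oU Ux (smooth_on_pderiv _ sU) (E i) (obalW ox)).
exact: pderiv2_min oU Ux sU fm.
Qed.

Lemma smooth_cbal_continuous f : smooth_cbal f -> {within (@cbal R n), continuous f}.
Proof.
move=> sf; apply/subspace_continuousP => x bx.
have [U [F [[oU Ux] sF eF]]] := sf x bx.
have cF : {for x, continuous F} by exact: smooth_on_continuous Ux.
suff H : f y @[y --> within (@cbal R n) (nbhs x)] --> F x.
  by rewrite (eF x Ux bx) in H; exact: H.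
have : F y @[y --> within (@cbal R n) (nbhs x)] --> F x.
  by apply: cvg_trans cF; apply: cvg_app; exact: cvg_within.
apply: cvg_trans; apply: near_eq_cvg.
near=> y; apply: eF; last by near: y; exact: withinT.
by near: y; apply: cvg_within; exact: open_nbhs_nbhs.
Unshelve. all: by end_near. Qed.

End BallDerivatives.

(** * Gradient and Laplacian *)

Section GradLap.
Context {R : realType} {n : nat}.
Implicit Types (f g h : 'rV[R]_n -> R) (x y v : 'rV[R]_n).

Definition grad_dot f g x : R := \sum_i bd i f x * bd i g x.
Definition lap f x : R := \sum_i bd i (bd i f) x.
Definition hessdot f g x : R :=
  \sum_i \sum_j bd i (bd j f) x * bd i (bd j g) x.

Lemma grad_dot_eq f f' g g' x : (forall y, cbal y -> f y = f' y) ->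
  (forall y, cbal y -> g y = g' y) -> grad_dot f g x = grad_dot f' g' x.
Proof.
by move=> ff gg; apply: eq_bigr => i _; rewrite (bd_eq i x ff) (bd_eq i x gg).
Qed.

Lemma lap_eq f g x : (forall y, cbal y -> f y = g y) -> lap f x = lap g x.
Proof.
by move=> fg; apply: eq_bigr => i _; apply: bd_eq => y _; exact: bd_eq.
Qed.

Lemma grad_dotC f g x : grad_dot f g x = grad_dot g f x.
Proof. by apply: eq_bigr => i _; exact: mulrC. Qed.

Lemma smooth_grad_dot f g : smooth_cbal f -> smooth_cbal g -> smooth_cbal (grad_dot f g).
Proof.
move=> sf sg; apply: (@smooth_cbal_sum _ _ _ _ (fun i y => bd i f y * bd i g y)).
by move=> i; apply: smooth_cbalM; exact: smooth_cbal_bd.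
Qed.

Lemma smooth_lap f : smooth_cbal f -> smooth_cbal (lap f).
Proof.
move=> sf; apply: (@smooth_cbal_sum _ _ _ _ (fun i => bd i (bd i f))).
by move=> i; do 2 apply: smooth_cbal_bd.
Qed.

Lemma grad_dotDr f g h x : smooth_cbal g -> smooth_cbal h -> cbal x ->
  grad_dot f (fun y => g y + h y) x = grad_dot f g x + grad_dot f h x.
Proof.
move=> sg sh bx; rewrite /grad_dot -big_split; apply: eq_bigr => i _ /=.
by rewrite (bdD i sg sh bx) mulrDr.
Qed.

Lemma grad_dotZr (c : R) f g x : smooth_cbal g -> cbal x ->
  grad_dot f (fun y => c * g y) x = c * grad_dot f g x.
Proof.
move=> sg bx; rewrite /grad_dot mulr_sumr; apply: eq_bigr => i _.
by rewrite (bdZ c i sg bx) mulrCA.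
Qed.

Lemma grad_dotMr f g h x : smooth_cbal g -> smooth_cbal h -> cbal x ->
  grad_dot f (fun y => g y * h y) x = g x * grad_dot f h x + h x * grad_dot f g x.
Proof.
move=> sg sh bx; rewrite /grad_dot !mulr_sumr -big_split; apply: eq_bigr => i _ /=.
rewrite (bdM i sg sh bx).
by move: (bd i f x) (bd i g x) (bd i h x) => *; ring.
Qed.

Lemma grad_dotEr f g x : smooth_cbal g -> cbal x ->
  grad_dot f (fun y => expR (g y)) x = expR (g x) * grad_dot f g x.
Proof.
move=> sg bx; rewrite /grad_dot mulr_sumr; apply: eq_bigr => i _.
by rewrite (bd_expR i sg bx) mulrCA.
Qed.

Lemma lapD f g x : smooth_cbal f -> smooth_cbal g -> cbal x ->
  lap (fun y => f y + g y) x = lap f x + lap g x.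
Proof.
move=> sf sg bx; rewrite /lap -big_split; apply: eq_bigr => i _ /=.
rewrite -(bdD i (smooth_cbal_bd i sf) (smooth_cbal_bd i sg) bx).
by apply: bd_eq => y byy; rewrite (bdD i sf sg byy).
Qed.

Lemma lapZ (c : R) f x : smooth_cbal f -> cbal x ->
  lap (fun y => c * f y) x = c * lap f x.
Proof.
move=> sf bx; rewrite /lap mulr_sumr; apply: eq_bigr => i _ /=.
rewrite -(bdZ c i (smooth_cbal_bd i sf) bx).
by apply: bd_eq => y byy; rewrite (bdZ c i sf byy).
Qed.

Lemma lapB f g x : smooth_cbal f -> smooth_cbal g -> cbal x ->
  lap (fun y => f y - g y) x = lap f x - lap g x.
Proof.
move=> sf sg bx; rewrite /lap -sumrB; apply: eq_bigr => i _ /=.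
rewrite -(bdB i (smooth_cbal_bd i sf) (smooth_cbal_bd i sg) bx).
by apply: bd_eq => y byy; rewrite (bdB i sf sg byy).
Qed.

Lemma lapN f x : smooth_cbal f -> cbal x -> lap (fun y => - f y) x = - lap f x.
Proof.
move=> sf bx; rewrite -mulN1r -(lapZ (-1) sf bx).
by apply: lap_eq => y _; rewrite mulN1r.
Qed.

Lemma grad_dotNr f g x : smooth_cbal g -> cbal x -> grad_dot f (fun y => - g y) x = - grad_dot f g x.
Proof.
move=> sg bx; rewrite -mulN1r -(grad_dotZr (-1) f sg bx).
by apply: grad_dot_eq => // y _; rewrite mulN1r.
Qed.

Lemma lapM f g x : smooth_cbal f -> smooth_cbal g -> cbal x ->
  lap (fun y => f y * g y) x = f x * lap g x + g x * lap f x + 2 * grad_dot f g x.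
Proof.
move=> sf sg bx; rewrite /lap /grad_dot !mulr_sumr -!big_split; apply: eq_bigr => i _ /=.
have sfi := smooth_cbal_bd i sf; have sgi := smooth_cbal_bd i sg.
transitivity (bd i (fun y => bd i f y * g y + f y * bd i g y) x).
  by apply: bd_eq => y byy; rewrite (bdM i sf sg byy).
rewrite (bdD i (smooth_cbalM sfi sg) (smooth_cbalM sf sgi) bx).
rewrite (bdM i sfi sg bx) (bdM i sf sgi bx).
by move: (bd i (bd i f) x) (bd i (bd i g) x) (bd i f x)
  (bd i g x) (f x) (g x) => *; ring.
Qed.

Lemma lapE f x : smooth_cbal f -> cbal x ->
  lap (fun y => expR (f y)) x = expR (f x) * (lap f x + grad_dot f f x).
Proof.
move=> sf bx; rewrite /lap /grad_dot -big_split mulr_sumr; apply: eq_bigr => i _ /=.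
have sfi := smooth_cbal_bd i sf.
transitivity (bd i (fun y => expR (f y) * bd i f y) x).
  by apply: bd_eq => y byy; rewrite (bd_expR i sf byy).
rewrite (bdM i (smooth_cbal_expR sf) sfi bx) (bd_expR i sf bx).
by rewrite -mulrA -mulrDr addrC.
Qed.

Lemma lap_bd f i x : smooth_cbal f -> cbal x ->
  lap (bd i f) x = bd i (lap f) x.
Proof.
move=> sf bx.
have sff j : smooth_cbal (bd j (bd j f)).
  by do 2 apply: smooth_cbal_bd.
rewrite [RHS](bd_sum _ i sff bx).
apply: eq_bigr => j _; rewrite (bd_sym i j (smooth_cbal_bd j sf) bx).
by apply: bd_eq => y byy; exact: bd_sym.
Qed.

Lemma lap_sum (I : Type) (r : seq I) (F : I -> 'rV[R]_n -> R) x :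
  (forall j, smooth_cbal (F j)) -> cbal x ->
  lap (fun y => \sum_(j <- r) F j y) x = \sum_(j <- r) lap (F j) x.
Proof.
move=> sF bx; rewrite /lap exchange_big /=; apply: eq_bigr => i _.
rewrite -(bd_sum _ i (fun j => smooth_cbal_bd i (sF j)) bx).
by apply: bd_eq => y byy; exact: (bd_sum _ i sF byy).
Qed.

(** Polarised Bochner formula in flat space. Besides the Bochner formula
    proper ([f = g]) it gives the commutator of the Laplacian with the Euler
    field, since that field is the gradient of [qf]. *)
Lemma lap_grad_dot f g x : smooth_cbal f -> smooth_cbal g -> cbal x ->
  lap (grad_dot f g) x = grad_dot (lap f) g x + grad_dot f (lap g) x + 2 * hessdot f g x.
Proof.
move=> sf sg bx.
have sfi i := smooth_cbal_bd i sf; have sgi i := smooth_cbal_bd i sg.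
have sfg i : smooth_cbal (fun y => bd i f y * bd i g y).
  exact: (smooth_cbalM (sfi i) (sgi i)).
rewrite (lap_sum _ sfg bx).
rewrite /hessdot [X in 2 * X]exchange_big /= mulr_sumr /grad_dot -!big_split.
apply: eq_bigr => i _ /=.
rewrite (lapM (sfi i) (sgi i) bx) (lap_bd i sf bx) (lap_bd i sg bx).
by rewrite [bd i f x * _ + _]addrC [bd i g x * _]mulrC.
Qed.

Lemma grad_dot_grad_dot f x : smooth_cbal f -> cbal x ->
  grad_dot f (grad_dot f f) x =
  2 * \sum_i \sum_j bd i f x * bd j f x * bd i (bd j f) x.
Proof.
move=> sf bx; have sfi i := smooth_cbal_bd i sf.
rewrite /grad_dot mulr_sumr; apply: eq_bigr => i _.
have sff j : smooth_cbal (fun y => bd j f y * bd j f y).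
  exact: (smooth_cbalM (sfi j) (sfi j)).
rewrite (bd_sum _ i sff bx).
rewrite !mulr_sumr; apply: eq_bigr => j _.
rewrite (bdM i (sfi j) (sfi j) bx).
by move: (bd i (bd j f) x) (bd i f x) (bd j f x) => *; ring.
Qed.

(** Division by [k] and the case [k = 0] make this, for every [k], the
    primitive of [expR (k t)] that vanishes at [0]. *)
Definition psi (k t : R) : R := if k == 0 then t else (expR (k * t) - 1) / k.

Lemma smooth_psi k f : smooth_cbal f -> smooth_cbal (fun y => psi k (f y)).
Proof.
move=> sf; rewrite /psi; case: eqVneq => // _.
have s1 := smooth_cbalB (smooth_cbal_expR (smooth_cbalZ k sf)) (@smooth_cbalC _ _ 1).
exact: (smooth_cbalM s1 (@smooth_cbalC _ _ k^-1)).
Qed.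

Lemma bd_psi k f i x : smooth_cbal f -> cbal x ->
  bd i (fun y => psi k (f y)) x = expR (k * f x) * bd i f x.
Proof.
move=> sf bx; rewrite /psi; case: eqVneq => [->|k0].
  by rewrite mul0r expR0 mul1r.
have se := smooth_cbal_expR (smooth_cbalZ k sf).
have s1 := smooth_cbalB se (@smooth_cbalC _ _ 1).
rewrite (bdM i s1 (@smooth_cbalC _ _ k^-1) bx) (bdC _ _ bx) mulr0 addr0.
rewrite (bdB i se (@smooth_cbalC _ _ 1) bx) (bdC _ _ bx) subr0.
rewrite (bd_expR i (smooth_cbalZ k sf) bx) (bdZ k i sf bx).
by rewrite mulrCA mulrAC divff// mul1r.
Qed.

Lemma lap_psi k f x : smooth_cbal f -> cbal x ->
  lap (fun y => psi k (f y)) x = expR (k * f x) * (lap f x + k * grad_dot f f x).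
Proof.
move=> sf bx; rewrite /lap /grad_dot mulr_sumr -big_split mulr_sumr.
apply: eq_bigr => i _ /=.
have sfi := smooth_cbal_bd i sf.
have sk := smooth_cbalZ k sf.
transitivity (bd i (fun y => expR (k * f y) * bd i f y) x).
  by apply: bd_eq => y byy; rewrite (bd_psi k i sf byy).
rewrite (bdM i (smooth_cbal_expR sk) sfi bx) (bd_expR i sk bx).
rewrite (bdZ k i sf bx).
by move: (bd i (bd i f) x) (bd i f x) (expR _) => *; ring.
Qed.

End GradLap.

(** * Curvature of a conformally flat metric *)

Section Curvature.
Context {R : realType} {n : nat}.
Variables (G : 'rV[R]_n -> 'M[R]_n) (tau : 'rV[R]_n -> R).
Hypothesis n3 : (3 <= n)%N.
Hypothesis stau : smooth_cbal tau.
Hypothesis Gtau : forall x, cbal x -> G x = (expR (2 * tau x))%:M.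

Local Notation d i := (bd i tau).
Local Notation dd i j := (bd i (bd j tau)).
Local Notation delta i j := ((i == j)%:R : R).

Lemma sum_deltal (X : 'I_n -> R) k : \sum_i delta i k * X i = X k.
Proof.
rewrite (bigD1 k)//= eqxx mul1r big1 ?addr0// => i /negbTE ->.
by rewrite mul0r.
Qed.

Lemma sum_deltar (X : 'I_n -> R) k : \sum_i delta k i * X i = X k.
Proof.
by rewrite -[RHS](sum_deltal X); apply: eq_bigr => i _; rewrite eq_sym.
Qed.

Lemma sum_cst (c : R) : \sum_(i < n) c = n%:R * c.
Proof. by rewrite sumr_const card_ord mulr_natl. Qed.

Lemma conformal_ginv x k l : cbal x ->
  ginv G x k l = delta k l * expR (- (2 * tau x)).
Proof.
by move=> bx; rewrite /ginv (Gtau bx) invmx_scalar mxE -expRN [RHS]mulr_natl.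
Qed.

Lemma conformal_bd_metric i j l x : cbal x ->
  bderiv i (fun y => G y j l) x = delta j l * (2 * d i x) * expR (2 * tau x).
Proof.
move=> bx; rewrite bdE.
transitivity (bd i (fun y => delta j l * expR (2 * tau y)) x).
  by apply: bd_eq => y byy; rewrite (Gtau byy) mxE [RHS]mulr_natl.
have s2 := smooth_cbalZ 2 stau.
rewrite (bdZ _ i (smooth_cbal_expR s2) bx) (bd_expR i s2 bx) (bdZ 2 i stau bx).
by move: (_%:R) (expR _) (bd i tau x) => *; ring.
Qed.

Lemma conformal_christoffel k i j x : cbal x -> christoffel G k i j x =
  delta k j * d i x + delta k i * d j x - delta i j * d k x.
Proof.
move=> bx; rewrite /christoffel.
under eq_bigr => l _.
  rewrite (conformal_ginv _ _ bx) !(conformal_bd_metric _ _ _ bx) -mulrA.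
  over.
rewrite sum_deltar expRN (eq_sym k j) (eq_sym k i).
by field; rewrite gt_eqF// expR_gt0.
Qed.

Local Notation p x := (grad_dot tau tau x).
Local Notation L x := (lap tau x).
Local Notation N := (n%:R : R).

Lemma conformal_bd_christoffel m k i j x : cbal x ->
  bderiv m (christoffel G k i j) x =
  delta k j * dd m i x + delta k i * dd m j x - delta i j * dd m k x.
Proof.
move=> bx; rewrite bdE.
have sd i' : smooth_cbal (d i') by exact: smooth_cbal_bd.
have sz c i' : smooth_cbal (fun y => c * d i' y) by exact: smooth_cbalZ.
rewrite -!(bdZ _ m (sd _) bx) -(bdD m (sz _ _) (sz _ _) bx).
rewrite -(bdB m (smooth_cbalD (sz _ _) (sz _ _)) (sz _ _) bx).
by apply: bd_eq => y byy; rewrite conformal_christoffel.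
Qed.

(** The summands of the Ricci tensor, sorted by the Kronecker deltas that
    involve the summation index [i], so that summing over [i] collapses them. *)
Lemma conformal_riemann_trace i j k x : cbal x -> riemann G i k i j x =
  delta i k * (dd i j x - d i x * d j x)
  + (delta i j * (dd i k x - d i x * d k x + delta j k * p x)
  + (delta j k * (d i x * d i x) - delta j k * dd i i x
     - (dd j k x - d j x * d k x) - delta j k * p x)).
Proof.
move=> bx; rewrite /riemann.
rewrite (conformal_bd_christoffel i i j k bx) (conformal_bd_christoffel j i i k bx).
have E a b c := conformal_christoffel a b c bx.
move: (christoffel G) E => Gam E.
have G1 m : Gam i i m x = d m x.
  by rewrite E eqxx /=; ring.
have S1 a b : \sum_m d m x * Gam m a b x =
    2 * d a x * d b x - delta a b * p x.
  under eq_bigr => m _ do rewrite E.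
  rewrite (eq_bigr (fun m => delta m b * (d m x * d a x) +
    (delta m a * (d m x * d b x) - delta a b * (d m x * d m x)))); last first.
    by move=> m _; ring.
  rewrite big_split sumrB /= !sum_deltal -mulr_sumr -/(p x).
  by ring.
rewrite sumrB; under eq_bigr => m _ do rewrite G1.
rewrite S1.
have -> : \sum_m Gam i j m x * Gam m i k x =
    d j x * d k x + delta i j * (2 * d i x * d k x - delta i k * p x)
    - d i x * Gam j i k x.
  under eq_bigr => m _ do rewrite (E i j m).
  rewrite (eq_bigr (fun m => delta i m * (d j x * Gam m i k x) +
    (delta i j * (d m x * Gam m i k x)
     - delta j m * (d i x * Gam m i k x)))); last first.
    by move=> m _; ring.
  rewrite big_split sumrB /= !sum_deltar -mulr_sumr S1 G1.
  by ring.
rewrite E eqxx (eq_sym j i) /=.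
have -> : delta i j * (2 * d i x * d k x - delta i k * p x) =
   delta i j * (2 * d i x * d k x - delta j k * p x).
  by case: eqVneq => [->//|_]; rewrite !mul0r.
by ring.
Qed.

Lemma conformal_ricci j k x : cbal x -> ricci G x j k =
  (N - 2) * (d j x * d k x - dd j k x) - delta j k * (L x + (N - 2) * p x).
Proof.
move=> bx; rewrite mxE.
under eq_bigr => i _ do rewrite (conformal_riemann_trace _ _ _ bx).
rewrite !(big_split, sumrB) /= !sum_deltal !sum_cst.
rewrite sumrN -!mulr_sumr -/(p x) -/(L x) (bd_sym k j stau bx).
by ring.
Qed.

Lemma conformal_trace T x : cbal x ->
  trace_metric G T x = expR (- (2 * tau x)) * \sum_i T i i.
Proof.
move=> bx; rewrite /trace_metric mulr_sumr; apply: eq_bigr => i _.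
under eq_bigr => j _ do rewrite (conformal_ginv _ _ bx) -mulrA.
by rewrite sum_deltar.
Qed.

Lemma conformal_normsq T x : cbal x ->
  normsq_metric G T x =
  expR (- (2 * tau x)) ^+ 2 * \sum_i \sum_j T i j ^+ 2.
Proof.
move=> bx; rewrite /normsq_metric mulr_sumr; apply: eq_bigr => i _.
rewrite mulr_sumr; apply: eq_bigr => j _.
rewrite (eq_bigr (fun k => delta i k * (expR (- (2 * tau x)) * T i j *
   \sum_l delta j l * (expR (- (2 * tau x)) * T k l)))); last first.
  move=> k _; rewrite !mulr_sumr; apply: eq_bigr => l _.
  by rewrite !(conformal_ginv _ _ bx); ring.
by rewrite sum_deltar sum_deltar; ring.
Qed.

Lemma natr_ge3 : 3 <= N.
Proof. by rewrite (ler_nat R 3 n). Qed.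

Local Notation k := ((N - 4) / 2).

(** The trace of the Schouten tensor with respect to the flat metric: [Jcurv]
    without its conformal weight. *)
Definition flatJ x := - (L x + (k + 1) * p x).

Lemma smooth_flatJ : smooth_cbal flatJ.
Proof.
apply: smooth_cbalN; apply: smooth_cbalD; first exact: smooth_lap.
by apply: smooth_cbalZ; exact: smooth_grad_dot.
Qed.

Lemma conformal_Jcurv x : cbal x ->
  Jcurv G x = expR (- (2 * tau x)) * flatJ x.
Proof.
move=> bx; rewrite /Jcurv /scalar_curv (conformal_trace _ bx).
under eq_bigr => i _ do rewrite (conformal_ricci _ _ bx) eqxx mul1r.
rewrite sumrB -mulr_sumr sumrB sum_cst -/(p x) -/(L x) /flatJ.
have n3' := natr_ge3.
by field; rewrite subr_eq0 gt_eqF//; lra.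
Qed.

Lemma conformal_schouten i j x : cbal x -> schouten G x i j =
  d i x * d j x - dd i j x - delta i j * (p x / 2).
Proof.
move=> bx.
have E (a b : R) (A B : 'M[R]_n) :
  (a *: (A - b *: B)) i j = a * (A i j - b * B i j) by rewrite !mxE.
rewrite /schouten E.
rewrite (conformal_ricci _ _ bx) (conformal_Jcurv bx) (Gtau bx) [_%:M i j]mxE.
rewrite -[expR (2 * tau x) *+ _]mulr_natl /flatJ expRN.
have n3' := natr_ge3.
by field; rewrite gt_eqF ?expR_gt0//= subr_eq0 gt_eqF//; lra.
Qed.

Lemma conformal_laplacian f x : smooth_cbal f -> cbal x ->
  laplacian G f x =
  expR (- (2 * tau x)) * (lap f x + (N - 2) * grad_dot tau f x).
Proof.
move=> sf bx; rewrite /laplacian (conformal_trace _ bx); congr (_ * _).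
rewrite (eq_bigr (fun i => bd i (bd i f) x - (2 * (d i x * bd i f x) - grad_dot tau f x))).
  by rewrite sumrB sumrB sum_cst -mulr_sumr -/(grad_dot tau f x) -/(lap f x); ring.
move=> i _; rewrite mxE !bdE; congr (_ - _).
rewrite (eq_bigr (fun k => delta k i * (2 * d i x * bd k f x) - d k x * bd k f x)).
  by rewrite sumrB sum_deltal -mulrA.
by move=> k _; rewrite (conformal_christoffel _ _ _ bx) eqxx bdE /=; ring.
Qed.

(** The squared Hessian and the Hessian evaluated on the gradient are written
    as they occur in the Bochner formula, which lets them cancel in
    [bilaplacian_psi]. *)
Lemma schouten_sqr_sum x : cbal x -> \sum_i \sum_j schouten G x i j ^+ 2 =
  hessdot tau tau x - grad_dot tau (grad_dot tau tau) x + p x * L x + N / 4 * p x ^+ 2.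
Proof.
move=> bx.
have E i j : schouten G x i j ^+ 2 =
    dd i j x * dd i j x - 2 * (d i x * d j x * dd i j x)
    + (d i x * d i x) * (d j x * d j x)
    + delta i j * (p x * dd i j x - p x * (d i x * d j x) + p x ^+ 2 / 4).
  rewrite conformal_schouten//.
  by have [->|_] := eqVneq i j; rewrite /=; field.
rewrite (eq_bigr (fun i => \sum_j dd i j x * dd i j x
    - 2 * (\sum_j d i x * d j x * dd i j x)
    + (d i x * d i x) * p x
    + (p x * dd i i x - p x * (d i x * d i x) + p x ^+ 2 / 4))); last first.
  move=> i _; rewrite (eq_bigr _ (fun j _ => E i j)).
  rewrite !big_split sumrN -!mulr_sumr /= sum_deltar.
  by [].
rewrite !big_split !sumrN -!mulr_suml -!mulr_sumr /= sum_cst -/(p x) -/(L x).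
rewrite (grad_dot_grad_dot stau bx) /hessdot; ring.
Qed.

Theorem conformal_Qcurv x : cbal x -> Qcurv G x = expR (- (2 * tau x)) ^+ 2 *
  (lap (lap tau) x + (k + 1) * lap (grad_dot tau tau) x
   + 2 * (k - 1) * (grad_dot tau (lap tau) x + (k + 1) * grad_dot tau (grad_dot tau tau) x)
   + 2 * flatJ x * L x + 4 * k * flatJ x * p x
   - 2 * (hessdot tau tau x - grad_dot tau (grad_dot tau tau) x + p x * L x + N / 4 * p x ^+ 2)
   + (k + 2) * flatJ x ^+ 2).
Proof.
move=> bx; rewrite /Qcurv (conformal_normsq _ bx) (schouten_sqr_sum bx).
rewrite (conformal_Jcurv bx).
have sJ := smooth_flatJ; have sm := smooth_cbalN (smooth_cbalZ 2 stau).
have se := smooth_cbal_expR sm.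
have EJ y : cbal y -> Jcurv G y = expR (- (2 * tau y)) * flatJ y.
  exact: conformal_Jcurv.
have sJc : smooth_cbal (Jcurv G).
  by apply: smooth_cbal_eq (smooth_cbalM se sJ) => y byy; rewrite EJ.
rewrite (conformal_laplacian sJc bx).
rewrite (lap_eq x EJ) (grad_dot_eq x (fun _ _ => erefl) EJ).
rewrite (lapM se sJ bx) (grad_dotMr _ se sJ bx) (lapE sm bx) (grad_dotEr _ sm bx).
rewrite [grad_dot (fun y => expR _) _ x]grad_dotC (grad_dotEr _ sm bx).
have E2 f : grad_dot f (fun y => - (2 * tau y)) x = - (2 * grad_dot f tau x).
  by rewrite (grad_dotNr _ (smooth_cbalZ 2 stau) bx) (grad_dotZr 2 f stau bx).
have lap2 : lap (fun y => - (2 * tau y)) x = - (2 * L x).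
  by rewrite (lapN (smooth_cbalZ 2 stau) bx) (lapZ 2 stau bx).
rewrite lap2 E2 [grad_dot (fun y => - _) _ x]grad_dotC !E2.
have s1 := smooth_lap stau; have s2 := smooth_grad_dot stau stau.
have s12 : smooth_cbal (fun y => L y + (k + 1) * p y).
  exact: (smooth_cbalD s1 (smooth_cbalZ _ s2)).
have lapJ : lap flatJ x = - (lap (lap tau) x + (k + 1) * lap (grad_dot tau tau) x).
  by rewrite (lapN s12 bx) (lapD s1 (smooth_cbalZ _ s2) bx) (lapZ _ s2 bx).
have grJ : grad_dot tau flatJ x = - (grad_dot tau (lap tau) x + (k + 1) * grad_dot tau (grad_dot tau tau) x).
  by rewrite (grad_dotNr _ s12 bx) (grad_dotDr _ s1 (smooth_cbalZ _ s2) bx) (grad_dotZr _ _ s2 bx).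
rewrite [grad_dot flatJ tau x]grad_dotC lapJ grJ.
by field.
Qed.

(** Conformal covariance of the Paneitz operator, for a flat background. The
    fourth-order terms agree, the squared Hessians cancel by the Bochner
    formula, and the rest is an identity between polynomials in the Laplacian
    and the squared gradient of [tau]. *)
Theorem bilaplacian_psi x : cbal x ->
  lap (lap (fun y => psi k (tau y))) x = Qcurv G x * expR ((k + 4) * tau x).
Proof.
move=> bx; have s1 := smooth_lap stau; have s2 := smooth_grad_dot stau stau.
have sk := smooth_cbalZ k stau; have se := smooth_cbal_expR sk.
have s12 : smooth_cbal (fun y => L y + k * p y).
  exact: (smooth_cbalD s1 (smooth_cbalZ _ s2)).
have E y : cbal y -> lap (fun y => psi k (tau y)) y = expR (k * tau y) * (L y + k * p y).
  exact: lap_psi.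
have grk : grad_dot (fun y => k * tau y) (fun y => k * tau y) x = k ^+ 2 * p x.
  by rewrite (grad_dotZr _ _ stau bx) grad_dotC (grad_dotZr _ _ stau bx) mulrA.
have grM : grad_dot (fun y => expR (k * tau y)) (fun y => L y + k * p y) x =
    expR (k * tau x) * (k * (grad_dot tau (lap tau) x + k * grad_dot tau (grad_dot tau tau) x)).
  rewrite grad_dotC (grad_dotEr _ sk bx) (grad_dotZr _ _ stau bx) grad_dotC.
  by rewrite (grad_dotDr _ s1 (smooth_cbalZ _ s2) bx) (grad_dotZr _ _ s2 bx).
rewrite (lap_eq x E) (lapM se s12 bx) (lapE sk bx) grk grM (lapZ _ stau bx).
rewrite (lapD s1 (smooth_cbalZ _ s2) bx) (lapZ _ s2 bx).
rewrite (conformal_Qcurv bx) (lap_grad_dot stau stau bx) [grad_dot (lap tau) tau x]grad_dotC /flatJ.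
have -> : expR ((k + 4) * tau x) = expR (k * tau x) * expR (2 * tau x) ^+ 2.
  by rewrite expr2 -!expRD; congr expR; ring.
by rewrite expRN; field; rewrite gt_eqF// expR_gt0.
Qed.

End Curvature.

(** * The round metric and the factorisation of the Paneitz operator *)

Section Background.
Context {R : realType} {n : nat}.
Implicit Types (f g v : 'rV[R]_n -> R) (x y : 'rV[R]_n).

Local Notation N := (n%:R : R).

(** The reciprocal of the square root of the conformal factor of the round
    metric; its gradient is the Euler field, so [grad_dot qf] is the radial
    derivative. *)
Definition qf y : R := (1 + dot y y) / 2.
Definition tau0 y : R := - ln (qf y).

Lemma qf_gt0 y : 0 < qf y.
Proof. by rewrite /qf; have := @dot_ge0 R n y; lra. Qed.

Lemma qf_le1 y : cbal y -> qf y <= 1.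
Proof. by rewrite /cbal /= /qf; lra. Qed.

Lemma smooth_qf : smooth_cbal qf.
Proof.
apply: smooth_cbalM; last exact: smooth_cbalC.
apply: smooth_cbalD; first exact: smooth_cbalC.
by apply: smooth_onT; apply: smooth_dot; exact: openT.
Qed.

Lemma smooth_tau0 : smooth_cbal tau0.
Proof.
apply: smooth_cbalN; apply: smooth_cbal_ln; first exact: smooth_qf.
by move=> x _; exact: qf_gt0.
Qed.

Lemma expR_tau0 y : expR (tau0 y) = (qf y)^-1.
Proof. by rewrite /tau0 expRN lnK// posrE qf_gt0. Qed.

Lemma expR_Ntau0 y : expR (- tau0 y) = qf y.
Proof. by rewrite expRN expR_tau0 invrK. Qed.

Lemma bd_qf i x : cbal x -> bd i qf x = x 0 i.
Proof.
move=> bx; have sc j : smooth_cbal (fun y : 'rV[R]_n => y 0 j) by exact: smooth_cbal_coord.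
have scc j : smooth_cbal (fun y : 'rV[R]_n => y 0 j * y 0 j).
  by apply: smooth_cbalM.
have sd : smooth_cbal (fun y : 'rV[R]_n => \sum_j y 0 j * y 0 j).
  exact: (@smooth_cbal_sum _ _ _ _ (fun j y => y 0 j * y 0 j)).
transitivity (bd i (fun y => 2^-1 + 2^-1 * \sum_j y 0 j * y 0 j) x).
  by apply: bd_eq => y _; rewrite /qf /dot; field.
rewrite (bdD i (smooth_cbalC _) (smooth_cbalZ _ sd) bx) (bdC _ _ bx) add0r.
rewrite (bdZ _ i sd bx) (bd_sum _ i scc bx).
rewrite (eq_bigr (fun j => (j == i)%:R * (2 * x 0 j))); last first.
  move=> j _; rewrite (bdM i (sc j) (sc j) bx) (bd_coord j i bx) eq_sym; ring.
by rewrite sum_deltal mulKf.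
Qed.

Lemma bd2_qf i j x : cbal x -> bd i (bd j qf) x = (i == j)%:R.
Proof.
move=> bx; rewrite -(bd_coord j i bx); apply: bd_eq => y byy; exact: bd_qf.
Qed.

Lemma lap_qf x : cbal x -> lap qf x = N.
Proof.
move=> bx; rewrite /lap (eq_bigr (fun=> 1)); last first.
  by move=> i _; rewrite bd2_qf// eqxx.
by rewrite sum_cst mulr1.
Qed.

Lemma grad_dot_qf_qf x : cbal x -> grad_dot qf qf x = 2 * qf x - 1.
Proof.
move=> bx; rewrite /grad_dot (eq_bigr (fun i => x 0 i * x 0 i)).
  by rewrite -/(dot x x) /qf; field.
by move=> i _; rewrite bd_qf.
Qed.

Lemma grad_dot_qfE f x : cbal x -> grad_dot qf f x = \sum_i x 0 i * bd i f x.
Proof. by move=> bx; apply: eq_bigr => i _; rewrite bd_qf. Qed.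

Lemma lap_grad_dot_qf v x : smooth_cbal v -> cbal x ->
  lap (grad_dot qf v) x = 2 * lap v x + grad_dot qf (lap v) x.
Proof.
move=> sv bx; rewrite (lap_grad_dot smooth_qf sv bx).
rewrite (grad_dot_eq x (fun y byy => lap_qf byy) (fun _ _ => erefl)).
rewrite {1}/grad_dot big1; last by move=> i _; rewrite bdC// mul0r.
rewrite add0r addrC; congr (2 * _ + _); rewrite /hessdot /lap.
apply: eq_bigr => i _; rewrite -[RHS](sum_deltar (fun j => bd i (bd j v) x)).
by apply: eq_bigr => j _; rewrite bd2_qf.
Qed.

(** For [v = expR (n / 2 * tau0 - tau0) w] this is [- Laplacian w - n w] on
    the round sphere, times the same weight: conjugating the conformal
    Laplacian to the flat one removes the first-order terms. *)
Definition eigen_op (v : 'rV[R]_n -> R) (y : 'rV[R]_n) : R :=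
  - (qf y * qf y * lap v y) - N * (N + 2) / 4 * v y.

Lemma smooth_eigen_op v : smooth_cbal v -> smooth_cbal (eigen_op v).
Proof.
move=> sv; apply: smooth_cbalB; last exact: smooth_cbalZ.
apply: smooth_cbalN; apply: smooth_cbalM (smooth_lap sv).
by apply: smooth_cbalM; exact: smooth_qf.
Qed.

(** The right-hand side is the Paneitz operator minus [(n + 4) / 2 * Q_0] in
    weighted form. The constants are those for which the coefficients of [lap
    v] cancel: [N (N + 2) / 4 - (N + 4) (N - 2) / 4 = 2]. *)
Lemma paneitz_factor v x : smooth_cbal v -> cbal x ->
  - (qf x ^+ 2 * lap (eigen_op v) x) + (N + 4) * (N - 2) / 4 * eigen_op v x =
  qf x ^+ 3 * lap (lap (fun y => qf y * v y)) x
  - (N + 4) * (N - 2) / 4 * (N * (N + 2) / 4) * v x.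
Proof.
move=> sv bx; have sq := smooth_qf; have sl := smooth_lap sv.
have sqq := smooth_cbalM sq sq; have sqql := smooth_cbalM sqq sl.
set c := N * (N + 2) / 4.
have sc := smooth_cbalZ (- c) sv.
have L1 : lap (eigen_op v) x = - (lap (fun y => qf y * qf y * lap v y) x) - c * lap v x.
  transitivity (lap (fun y => -1 * (qf y * qf y * lap v y) + (- c) * v y) x).
    by apply: lap_eq => y _; rewrite /eigen_op -/c; ring.
  rewrite (lapD (smooth_cbalZ (-1) sqql) sc bx) (lapZ _ sqql bx) (lapZ _ sv bx).
  by ring.
rewrite L1 (lapM sqq sl bx) (lapM sq sq bx) (lap_qf bx).
rewrite [grad_dot (fun y => qf y * qf y) _ x]grad_dotC (grad_dotMr _ sq sq bx) (grad_dot_qf_qf bx).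
have E y : cbal y -> lap (fun y => qf y * v y) y = qf y * lap v y + N * v y + 2 * grad_dot qf v y.
  by move=> byy; rewrite (lapM sq sv byy) (lap_qf byy); ring.
have sg := smooth_grad_dot sq sv; have sql := smooth_cbalM sq sl.
have sN := smooth_cbalZ N sv; have s2g := smooth_cbalZ 2 sg.
rewrite (lap_eq x E) (lapD (smooth_cbalD sql sN) s2g bx) (lapD sql sN bx).
rewrite (lapZ _ sv bx) (lapZ _ sg bx) (lap_grad_dot_qf sv bx) (lapM sq sl bx) (lap_qf bx).
rewrite [grad_dot (lap v) qf x]grad_dotC /eigen_op -/c /c.
by field.
Qed.

(** Obtained by differentiating [expR (- tau0) = qf]. *)
Lemma grad_dot_tau0 f x : cbal x -> grad_dot f tau0 x = - (grad_dot f qf x / qf x).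
Proof.
move=> bx; have := grad_dotEr f (smooth_cbalN smooth_tau0) bx.
rewrite (grad_dot_eq x (fun _ _ => erefl) (fun y _ => expR_Ntau0 y)) expR_Ntau0.
rewrite (grad_dotNr _ smooth_tau0 bx) => ->; rewrite mulrN mulNr opprK mulrAC divff ?mul1r//.
by rewrite gt_eqF// qf_gt0.
Qed.

Lemma grad_dot_tau0_tau0 x : cbal x -> grad_dot tau0 tau0 x = (2 * qf x - 1) / qf x ^+ 2.
Proof.
move=> bx; rewrite (grad_dot_tau0 _ bx) grad_dotC (grad_dot_tau0 _ bx) (grad_dot_qf_qf bx).
by field; rewrite gt_eqF// qf_gt0.
Qed.

Lemma lap_tau0 x : cbal x ->
  lap tau0 x = (2 * qf x - 1) / qf x ^+ 2 - N / qf x.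
Proof.
move=> bx; have := lapE (smooth_cbalN smooth_tau0) bx.
rewrite (lap_eq x (fun y _ => expR_Ntau0 y)) expR_Ntau0 (lap_qf bx).
rewrite (lapN smooth_tau0 bx).
have -> : grad_dot (fun y => - tau0 y) (fun y => - tau0 y) x = grad_dot tau0 tau0 x.
  by apply: eq_bigr => i _; rewrite (bdN i smooth_tau0 bx) mulrNN.
rewrite (grad_dot_tau0_tau0 bx).
have q0 : qf x != 0 by rewrite gt_eqF// qf_gt0.
by move/(congr1 (fun z => z / qf x)); rewrite mulrAC divff// mul1r => ->; ring.
Qed.

Section RoundCurvature.
Variable G : 'rV[R]_n -> 'M[R]_n.
Hypothesis n3 : (3 <= n)%N.
Hypothesis Gtau : forall x, cbal x -> G x = (expR (2 * tau0 x))%:M.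

Lemma round_Jcurv x : cbal x -> Jcurv G x = N / 2.
Proof.
move=> bx; rewrite (conformal_Jcurv n3 smooth_tau0 Gtau bx) /flatJ.
rewrite (grad_dot_tau0_tau0 bx) (lap_tau0 bx).
have -> : expR (- (2 * tau0 x)) = qf x ^+ 2.
  by rewrite -mulrN -[2]/(2%:R) expRM_natl expR_Ntau0.
by field; rewrite gt_eqF// qf_gt0.
Qed.

Lemma bd_tau0 i x : cbal x -> bd i tau0 x = - (x 0 i / qf x).
Proof.
move=> bx; have := bd_expR i (smooth_cbalN smooth_tau0) bx.
rewrite (bd_eq i x (fun y _ => expR_Ntau0 y)) expR_Ntau0 (bdN i smooth_tau0 bx).
rewrite (bd_qf i bx) => ->; rewrite mulrN mulNr opprK mulrAC divff ?mul1r//.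
by rewrite gt_eqF// qf_gt0.
Qed.

Lemma bd2_tau0 i j x : cbal x -> bd i (bd j tau0) x =
  x 0 i * x 0 j / qf x ^+ 2 - (i == j)%:R / qf x.
Proof.
move=> bx.
have sc : smooth_cbal (fun y : 'rV[R]_n => y 0 j) by exact: smooth_cbal_coord.
have se := smooth_cbal_expR smooth_tau0.
transitivity (bd i (fun y => -1 * (y 0 j * expR (tau0 y))) x).
  by apply: bd_eq => y byy; rewrite (bd_tau0 j byy) expR_tau0 mulN1r.
rewrite (bdZ _ i (smooth_cbalM sc se) bx) (bdM i sc se bx) (bd_coord _ _ bx).
rewrite (bd_expR i smooth_tau0 bx) (bd_tau0 i bx) expR_tau0.
by field; rewrite gt_eqF// qf_gt0.
Qed.

Lemma round_schouten i j x : cbal x ->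
  schouten G x i j = (i == j)%:R * (2 * qf x ^+ 2)^-1.
Proof.
move=> bx; rewrite (conformal_schouten n3 smooth_tau0 Gtau _ _ bx).
rewrite (grad_dot_tau0_tau0 bx) !(bd_tau0 _ bx) (bd2_tau0 _ _ bx).
by field; rewrite gt_eqF// qf_gt0.
Qed.

Lemma round_Qcurv x : cbal x -> Qcurv G x = N * (N ^+ 2 - 4) / 8.
Proof.
move=> bx; rewrite /Qcurv (conformal_normsq Gtau _ bx) (round_Jcurv bx).
have sJ : smooth_cbal (Jcurv G).
  by apply: smooth_cbal_eq (@smooth_cbalC _ _ (N / 2)) => y byy; rewrite round_Jcurv.
rewrite (conformal_laplacian smooth_tau0 Gtau sJ bx).
have -> : lap (Jcurv G) x = 0.
  rewrite /lap big1// => i _; rewrite -[RHS](bdC 0 i bx); apply: bd_eq => y byy.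
  by rewrite -(bdC (N / 2) i byy); apply: bd_eq => z bz; exact: round_Jcurv.
have -> : grad_dot tau0 (Jcurv G) x = 0.
  rewrite /grad_dot big1// => i _.
  have -> : bd i (Jcurv G) x = 0; last by rewrite mulr0.
  by rewrite -(bdC (N / 2) i bx); apply: bd_eq => z bz; exact: round_Jcurv.
rewrite (eq_bigr (fun i => (2 * qf x ^+ 2)^-1 ^+ 2)); last first.
  move=> i _; rewrite -[RHS](sum_deltar (fun=> (2 * qf x ^+ 2)^-1 ^+ 2) i).
  apply: eq_bigr => j _; rewrite round_schouten//.
  by case: eqVneq => _; rewrite /=; ring.
rewrite sum_cst.
have -> : expR (- (2 * tau0 x)) = qf x ^+ 2.
  by rewrite -mulrN -[2]/(2%:R) expRM_natl expR_Ntau0.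
by field; rewrite gt_eqF// qf_gt0.
Qed.

End RoundCurvature.

End Background.

(** * Maximum principles *)

Section MaximumPrinciples.
Context {R : realType} {n : nat}.
Implicit Types (f g h v : 'rV[R]_n -> R) (x y e : 'rV[R]_n).

Local Notation N := (n%:R : R).

Lemma cbal_bounded : bounded_set (@cbal R n).
Proof.
exists 1; split => // M M1 y By; apply: le_trans (ltW M1).
rewrite /Num.Def.normr /= mx_normrE; apply: bigmax_le => // -[i j] _ /=.
have : y i j ^+ 2 <= 1.
  rewrite (ord1 i); apply: le_trans By; rewrite /dot (bigD1 j)//= -expr2 lerDl.
  by apply: sumr_ge0 => l _; rewrite -expr2 sqr_ge0.
by rewrite -real_normK ?num_real// expr_le1.
Qed.

(** [h] is controlled on the closed ball only, so the limit point is first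
    placed in the ball and continuity is used within it. *)
Lemma sublevel_closed h : smooth_cbal h -> closed [set y | cbal y /\ h y <= 0].
Proof.
move=> sh x cx.
have bx : cbal x.
  by apply: cbal_closed => B /cx[y [[By _] yB]]; exists y.
split => //; rewrite leNgt; apply/negP => hx.
have := smooth_cbal_continuous sh; move/subspace_continuousP => /(_ x bx) ch.
have : \forall y \near within (@cbal R n) (nbhs x), 0 < h y by exact: (cvgr_gt _ ch).
rewrite /within /= => /cx[y [[By hy] /= /(_ By)]].
by rewrite ltNge hy.
Qed.

Lemma sublevel_compact h : smooth_cbal h -> compact [set y | cbal y /\ h y <= 0].
Proof.
move=> sh; apply: (subclosed_compact _ (bounded_closed_compact cbal_bounded (@cbal_closed R n))).
  exact: sublevel_closed.
by move=> y [].
Qed.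

Lemma sublevel_min h f : smooth_cbal h -> smooth_cbal f ->
  forall y0, cbal y0 -> h y0 <= 0 ->
  exists x, [/\ cbal x, h x <= 0 & forall y, cbal y -> h y <= 0 -> f x <= f y].
Proof.
move=> sh sf y0 By0 hy0.
have K0 : [set y | cbal y /\ h y <= 0] !=set0 by exists y0.
have cf : {within [set y | cbal y /\ h y <= 0], continuous f}.
  by apply: continuous_subspaceW (smooth_cbal_continuous sf) => y [].
have [x] := EVT_min_rV K0 (sublevel_compact sh) cf.
rewrite inE => -[Bx hx] fm; exists x; split => // y By hy.
by apply: fm; rewrite inE.
Qed.

Lemma cbal_min f y0 : smooth_cbal f -> cbal y0 ->
  exists2 x, cbal x & forall y, cbal y -> f x <= f y.
Proof.
move=> sf By0.
have [x [Bx _ fm]] := sublevel_min (smooth_cbalC 0) sf By0 (lexx 0).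
by exists x => // y By; exact: fm.
Qed.

Lemma lap_local_min f x : smooth_cbal f -> obal x ->
  (\forall y \near x, f x <= f y) -> 0 <= lap f x.
Proof. by move=> sf ox fm; apply: sumr_ge0 => i _; exact: bd2_min. Qed.

(** The Laplacian is nonnegative at an interior minimum. *)
Lemma min_principle f : smooth_cbal f ->
  (forall x, sphere x -> 0 <= f x) ->
  (forall x, obal x -> f x < 0 -> lap f x < 0) ->
  forall x, cbal x -> 0 <= f x.
Proof.
move=> sf fs fl y By; have [x Bx fm] := cbal_min sf By.
apply: le_trans (fm y By); rewrite leNgt; apply/negP => fx.
have [ox|sx] := cbal_obal_sphere Bx; last by have := fs x sx; rewrite leNgt fx.
have := fl x ox fx; rewrite ltNge lap_local_min//.
near=> z; apply: fm; apply: obalW; near: z.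
exact: open_nbhs_nbhs (conj obal_open ox).
Unshelve. all: by end_near. Qed.

(** One-sided first-order condition. Only a short initial segment has to lie
    in the closed ball, so boundary points are covered. *)
Lemma derivative_ge0 f x e : smooth_cbal f -> cbal x ->
  (\forall t \near (0 : R)^'+, cbal (x + t *: e) /\ f x <= f (x + t *: e)) ->
  0 <= \sum_i e 0 i * bd i f x.
Proof.
move=> sf bx fe; have [U [F [[oU Ux] sF eF]]] := sf x bx.
have dF : differentiable F x by exact: smooth_on_diff sF Ux.
rewrite (eq_bigr (fun i => e 0 i * pderiv i F x)); last first.
  by move=> i _; rewrite (bd_ext i oU Ux sF eF bx).
rewrite -deriveE_pderiv//; apply: derive_ge0_right => //.
have ce : {for (0 : R), continuous (fun t : R => x + t *: e)}.
  apply: continuousD; first exact: cst_continuous.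
  exact: continuousZr_tmp.
have nU : \forall t \near (0 : R), U (x + t *: e).
  by apply: ce; rewrite /= scale0r addr0; exact: open_nbhs_nbhs.
near=> t.
have [Bt ft] : cbal (x + t *: e) /\ f x <= f (x + t *: e) by near: t.
rewrite (eF x Ux bx) eF//.
by near: t; rewrite /at_right; apply: cvg_within; exact: nU.
Unshelve. all: by end_near. Qed.

Lemma sphere_inhabited : (0 < n)%N -> exists x : 'rV[R]_n, sphere x.
Proof.
move=> n0; exists (delta_mx 0 (Ordinal n0)).
rewrite /sphere /= /dot (bigD1 (Ordinal n0))//= big1 => [|i].
  by rewrite mxE !eqxx mul1r addr0.
by rewrite mxE => /negbTE ->; rewrite andbF mul0r.
Qed.

Lemma dotDD x e (t : R) :
  dot (x + t *: e) (x + t *: e) = dot x x + 2 * t * dot x e + t ^+ 2 * dot e e.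
Proof.
rewrite /dot !mulr_sumr -!big_split /=; apply: eq_bigr => i _.
by rewrite !mxE; ring.
Qed.

Lemma obal_ray x e : obal x ->
  \forall t \near (0 : R)^'+, obal (x + t *: e).
Proof.
move=> ox.
have ce : {for (0 : R), continuous (fun t : R => x + t *: e)}.
  apply: continuousD; first exact: cst_continuous.
  exact: continuousZr_tmp.
rewrite /at_right; apply: cvg_within; apply: ce; rewrite /= scale0r addr0.
exact: open_nbhs_nbhs (conj obal_open ox).
Qed.

Lemma sphere_ray x e : sphere x -> dot x e < 0 ->
  \forall t \near (0 : R)^'+, cbal (x + t *: e).
Proof.
move=> sx xe; near=> t.
have t0 : 0 < t by near: t; exact: nbhs_right_gt.
rewrite /cbal /= dotDD sx.
have : t < (- 2 * dot x e) / (dot e e + 1).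
  near: t; apply: nbhs_right_lt; rewrite divr_gt0//; first by lra.
  by have := dot_ge0 e; lra.
rewrite ltr_pdivlMr; last by have := dot_ge0 e; lra.
by have := dot_ge0 e; move: (dot e e) (dot x e) t0 => a b; nra.
Unshelve. all: by end_near. Qed.

(** At an interior zero every direction is admissible. At a boundary zero so
    are the directions pointing inward, for instance minus the gradient
    corrected by a normal vector, and the normal derivative contributes
    nothing. *)
Lemma gradient0 v x : smooth_cbal v -> cbal x ->
  (forall y, cbal y -> 0 <= v y) ->
  (forall y, sphere y -> grad_dot qf v y = 0) -> v x = 0 -> forall i, bd i v x = 0.
Proof.
move=> sv bx v0 vr vx.
pose g : 'rV[R]_n := \row_i bd i v x.
have dg e : \sum_i e 0 i * bd i v x = dot e g.
  by apply: eq_bigr => i _; rewrite mxE.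
suff g0 : dot g g = 0.
  move=> i; move/eqP: g0; rewrite dot_eq0 => /eqP/rowP/(_ i).
  by rewrite !mxE.
apply/eqP; rewrite eq_le dot_ge0 andbT.
have [ox|sx] := cbal_obal_sphere bx.
  have := @derivative_ge0 v x (- g) sv bx; rewrite dg.
  have -> : dot (- g) g = - dot g g.
    by rewrite /dot -sumrN; apply: eq_bigr => i _; rewrite [in LHS]mxE mulNr.
  rewrite oppr_ge0; apply.
  near=> t.
  have ot : obal (x + t *: - g) by near: t; exact: obal_ray.
  by split; [exact: obalW|rewrite vx; apply: v0; exact: obalW].
have xg : dot x g = 0 by rewrite -dg -grad_dot_qfE// vr.
have := @derivative_ge0 v x (- x - g) sv bx; rewrite dg.
have -> : dot (- x - g) g = - dot x g - dot g g.
  rewrite /dot -!sumrN -big_split /=; apply: eq_bigr => i _.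
  by rewrite [(- x - g) 0 i]mxE [(- x) 0 i]mxE [(- g) 0 i]mxE mulrDl !mulNr.
rewrite xg oppr0 add0r oppr_ge0; apply.
near=> t.
have bt : cbal (x + t *: (- x - g)).
  near: t; apply: sphere_ray => //.
  have -> : dot x (- x - g) = - dot x x - dot x g.
    rewrite /dot -!sumrN -big_split /=; apply: eq_bigr => i _.
    by rewrite [(- x - g) 0 i]mxE [(- x) 0 i]mxE [(- g) 0 i]mxE mulrDr !mulrN.
  by rewrite xg sx; lra.
by split => //; rewrite vx; exact: v0.
Unshelve. all: by end_near. Qed.

(** Hopf boundary-point lemma: if [v q > 0], take the largest ball around [q]
    free of zeros of [v] and a zero [x0] on its boundary. In an annulus [v]
    dominates a multiple of the barrier [expR (- a |y - q|^2) - expR (- a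
    r^2)], whose derivative at [x0] towards [q] is positive, whereas the
    gradient of [v] vanishes there. No point of the sphere is strictly closer
    to [q] than [x0], so the ball touches the unit sphere from inside at
    worst. *)
Lemma superharmonic_eq0 v : (0 < n)%N -> smooth_cbal v ->
  (forall y, cbal y -> 0 <= v y) ->
  (forall y, obal y -> lap v y <= 0) ->
  (forall y, sphere y -> v y = 0) ->
  (forall y, sphere y -> grad_dot qf v y = 0) ->
  forall y, cbal y -> v y = 0.
Proof.
move=> n0 sv v0 lv vs vr q Bq; apply/eqP; rewrite eq_le v0// andbT leNgt.
apply/negP => vq.
have [s ss] := sphere_inhabited n0.
have sc j : smooth_cbal (fun y : 'rV[R]_n => y 0 j) by exact: smooth_cbal_coord.
pose D y := dot (y - q) (y - q).
have sD : smooth_cbal D.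
  apply: (@smooth_cbal_sum _ _ _ _ (fun j (y : 'rV[R]_n) => (y - q) 0 j * (y - q) 0 j)) => j.
  have sj : smooth_cbal (fun y : 'rV[R]_n => (y - q) 0 j).
    by apply: smooth_cbal_eq (smooth_cbalB (sc j) (smooth_cbalC (q 0 j))) => y _; rewrite !mxE.
  exact: smooth_cbalM.
have bdD' i y : cbal y -> bd i D y = 2 * (y - q) 0 i.
  move=> By.
  have sj j : smooth_cbal (fun y : 'rV[R]_n => y 0 j - q 0 j).
    exact: (smooth_cbalB (sc j) (smooth_cbalC (q 0 j))).
  have sjj j : smooth_cbal (fun y : 'rV[R]_n => (y 0 j - q 0 j) * (y 0 j - q 0 j)).
    by apply: smooth_cbalM.
  transitivity (bd i (fun y => \sum_j (y 0 j - q 0 j) * (y 0 j - q 0 j)) y).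
    by apply: bd_eq => z _; apply: eq_bigr => j _; rewrite !mxE.
  rewrite (bd_sum _ i sjj By).
  rewrite (eq_bigr (fun j => (j == i)%:R * (2 * (y 0 j - q 0 j)))).
    by rewrite sum_deltal !mxE.
  move=> j _; rewrite (bdM i (sj j) (sj j) By) (bdB i (sc j) (smooth_cbalC _) By).
  by rewrite (bd_coord j i By) (bdC _ _ By) eq_sym; ring.
have lapD' y : cbal y -> lap D y = 2 * N.
  move=> By; rewrite /lap (eq_bigr (fun=> 2)); first by rewrite sum_cst mulrC.
  move=> i _; transitivity (bd i (fun y => 2 * (y 0 i - q 0 i)) y).
    by apply: bd_eq => z Bz; rewrite bdD'// !mxE.
  rewrite (bdZ _ i (smooth_cbalB (sc i) (smooth_cbalC _)) By).
  rewrite (bdB i (sc i) (smooth_cbalC _) By) (bd_coord i i By) (bdC _ _ By).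
  by rewrite eqxx /= subr0 mulr1.
have grD y : cbal y -> grad_dot D D y = 4 * D y.
  move=> By; rewrite /grad_dot /D /dot mulr_sumr; apply: eq_bigr => i _.
  by rewrite bdD'//; ring.
have vs0 : v s <= 0 by rewrite vs.
have Bs : cbal s by rewrite /cbal /= ss.
(* [x0] is a zero of [v] nearest to [q]; zeros exist, on the unit sphere *)
have [x0 [Bx0 vx0 x0m]] := sublevel_min sv sD Bs vs0.
have {}vx0 : v x0 = 0 by apply/eqP; rewrite eq_le vx0 v0.
set r2 := D x0 in x0m.
have r20 : 0 < r2.
  rewrite lt_neqAle dot_ge0 andbT eq_sym dot_eq0 subr_eq0.
  by apply/eqP => E; move: vq; rewrite -E vx0 ltxx.
have vpos y : cbal y -> D y < r2 -> 0 < v y.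
  move=> By Dy; rewrite lt_neqAle v0// andbT eq_sym; apply/eqP => vy.
  by have := x0m y By; rewrite vy lexx => /(_ isT); rewrite leNgt Dy.
have Dq : D q = 0 by rewrite /D subrr /dot big1// => i _; rewrite mxE mul0r.
(* the minimum [m] of [v] on the half-radius ball scales the barrier, which is at most 1 *)
have sD4 : smooth_cbal (fun y => D y - r2 / 4) by apply: smooth_cbalB => //; exact: smooth_cbalC.
have Dq4 : D q - r2 / 4 <= 0 by rewrite Dq; lra.
have [xm [Bxm Dxm xmm]] := sublevel_min sD4 sv Bq Dq4.
pose m := v xm.
have m0 : 0 < m by apply: vpos => //; lra.
(* large enough for the barrier to be strictly subharmonic where [D y > r2 / 4] *)
pose a := (2 * N + 1) / r2.
have a0 : 0 < a by rewrite divr_gt0// ltr_pwDr// mulr_ge0.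
have ar : a * r2 = 2 * N + 1 by rewrite /a divfK// gt_eqF.
clearbody a.
pose b y := expR (- a * D y) - expR (- a * r2).
have sa : smooth_cbal (fun y => - a * D y) by exact: smooth_cbalZ.
have sea := smooth_cbal_expR sa.
have sb : smooth_cbal b by apply: smooth_cbalB => //; exact: smooth_cbalC.
have bdb i y : cbal y -> bd i b y = expR (- a * D y) * (- a * (2 * (y - q) 0 i)).
  move=> By; rewrite (bdB i sea (smooth_cbalC _) By) (bdC _ _ By) subr0.
  by rewrite (bd_expR i sa By) (bdZ _ i sD By) bdD'.
have lapb y : cbal y -> lap b y = expR (- a * D y) * (2 * a * (2 * a * D y - N)).
  move=> By.
  have -> : lap b y = lap (fun y => expR (- a * D y)) y.
    apply: eq_bigr => i _; apply: bd_eq => z Bz.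
    by rewrite (bdB i sea (smooth_cbalC _) Bz) (bdC _ _ Bz) subr0.
  rewrite (lapE sa By) (lapZ _ sD By) lapD'// (grad_dotZr _ _ sD By) grad_dotC (grad_dotZr _ _ sD By) grD//.
  by congr (_ * _); ring.
have b1 y : b y <= 1.
  have : expR (- a * D y) <= 1.
    by rewrite -expR0 ler_expR mulNr oppr_le0 mulr_ge0// ?dot_ge0// ltW.
  have := expR_ge0 (- a * r2); rewrite /b; lra.
pose u y := v y - m * b y.
have smb : smooth_cbal (fun y => m * b y) by exact: smooth_cbalZ.
have su : smooth_cbal u by exact: smooth_cbalB.
have u0 y : cbal y -> D y <= r2 -> 0 <= u y.
  have sDr : smooth_cbal (fun y => D y - r2) by apply: smooth_cbalB => //; exact: smooth_cbalC.
  have Dqr : D q - r2 <= 0 by rewrite Dq; lra.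
  have [y1 [By1 Dy1 y1m]] := sublevel_min sDr su Bq Dqr.
  move=> By Dy; apply: (le_trans _ (y1m y By _)); last by rewrite subr_le0.
  rewrite leNgt; apply/negP => uy1.
  have [D4|D4] := leP (D y1) (r2 / 4).
    have : m <= v y1 by apply: xmm => //; rewrite subr_le0.
    have : m * b y1 <= m by rewrite ler_piMr// ltW.
    by move: uy1; rewrite /u; lra.
  have Dlt : D y1 < r2.
    rewrite lt_neqAle -subr_le0 Dy1 andbT; apply/eqP => E.
    by move: uy1; rewrite /u /b E subrr mulr0 subr0 ltNge v0.
  have oy1 : obal y1.
    have [//|sy1] := cbal_obal_sphere By1.
    by have := vpos y1 By1 Dlt; rewrite vs// ltxx.
  have : 0 <= lap u y1.
    apply: lap_local_min => //.
    have cD : {for y1, continuous D}.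
      have [U [oU Uy] [sU _]] := smooth_cbal_interior sD oy1.
      exact: smooth_on_continuous sU Uy.
    near=> z; apply: y1m.
      apply: obalW; near: z; exact: open_nbhs_nbhs (conj obal_open oy1).
    rewrite subr_le0 ltW//; near: z; exact: near_ltr.
  have -> : lap u y1 = lap v y1 - m * lap b y1.
    rewrite -(lapZ m sb By1) -mulN1r -(lapZ (-1) smb By1) -(lapD sv (smooth_cbalZ _ smb) By1).
    by apply: lap_eq => z _; rewrite mulN1r.
  have : 0 < m * lap b y1.
    rewrite lapb// mulr_gt0// mulr_gt0 ?expR_gt0//.
    have aD : a * r2 / 4 < a * D y1 by rewrite -mulrA ltr_pM2l.
    rewrite !mulr_gt0// subr_gt0 -mulrA; move: aD; rewrite ar.
    by move: (a * D y1) => z; have := ler0n R n; lra.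
  by have := lv y1 oy1; lra.
have ux0 : u x0 = 0 by rewrite /u vx0 /b subrr mulr0 subr0.
pose e := q - x0.
have De t : D (x0 + t *: e) = (1 - t) ^+ 2 * r2.
  rewrite /r2 /D /dot mulr_sumr; apply: eq_bigr => i _.
  by rewrite /e !mxE; ring.
have := @derivative_ge0 u x0 e su Bx0.
rewrite (eq_bigr (fun i => - (m * (expR (- a * r2) * (2 * a * ((x0 - q) 0 i * (x0 - q) 0 i)))))); last first.
  move=> i _; rewrite (bdB i sv smb Bx0) (bdZ m i sb Bx0) bdb//.
  by rewrite (gradient0 sv Bx0 v0 vr vx0) /e !mxE; ring.
rewrite sumrN -!mulr_sumr -/(dot _ _) -/(D x0) -/r2.
have pos : 0 < m * (expR (- a * r2) * (2 * a * r2)) by rewrite !mulr_gt0// expR_gt0.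
have cond : \forall t \near (0 : R)^'+, cbal (x0 + t *: e) /\ u x0 <= u (x0 + t *: e).
  near=> t.
  have t0 : 0 < t by near: t; exact: nbhs_right_gt.
  have t1 : t < 1 by near: t; exact: nbhs_right_lt.
  have Bt : cbal (x0 + t *: e).
    rewrite /cbal /=.
    have -> : dot (x0 + t *: e) (x0 + t *: e) =
        (1 - t) * dot x0 x0 + t * dot q q - t * (1 - t) * r2.
      rewrite /r2 /D /dot !mulr_sumr -big_split /= -sumrB.
      by apply: eq_bigr => i _; rewrite /e !mxE; ring.
    have := ltW r20; move: Bx0 Bq; rewrite /cbal /=.
    move: (dot x0 x0) (dot q q) => A B A1 B1 r0.
    have : 0 <= t * (1 - t) * r2 by rewrite !mulr_ge0// ?subr_ge0 ltW.
    have : (1 - t) * A <= (1 - t) * 1 by rewrite ler_wpM2l// subr_ge0 ltW.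
    have : t * B <= t * 1 by rewrite ler_wpM2l// ltW.
    lra.
  split => //; rewrite ux0; apply: u0 => //; rewrite De.
  apply: ler_piMl; first exact: ltW.
  by rewrite expr_le1 //; clear - t0 t1; lra.
by move/(_ cond); rewrite oppr_ge0 leNgt pos.
Unshelve. all: by end_near. Qed.

End MaximumPrinciples.

(** * Supersolutions at the first eigenvalue *)

Section BallRigidity.
Context {R : realType} {n : nat}.
Implicit Types (f g h v : 'rV[R]_n -> R) (x y e : 'rV[R]_n).

Local Notation N := (n%:R : R).

Lemma cbal_bound f : smooth_cbal f ->
  exists2 C, 0 <= C & forall y, cbal y -> `|f y| <= C.
Proof.
move=> sf; have B0 : cbal (0 : 'rV[R]_n).
  by rewrite /cbal /= /dot big1// => i _; rewrite mxE mul0r.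
have [x Bx fx] := cbal_min sf B0.
have [z Bz fz] := cbal_min (smooth_cbalN sf) B0.
exists (`|f x| + `|f z|) => [|y By]; first by rewrite addr_ge0.
rewrite ler_norml; apply/andP; split.
  have := fx y By; have := ler_norm (- f x); rewrite normrN.
  by have := normr_ge0 (f z); lra.
have := fz y By; have := ler_norm (f z).
by have := normr_ge0 (f x); lra.
Qed.

(** Mean value theorem along the ray through [x], up to the unit sphere where
    [g] vanishes. The bound [1 / 4] keeps the radial unit vector comparable to
    [x]. Differentiability is used in the open ball only, continuity up to its
    boundary. *)
Lemma radial_bound g (A : R) x : smooth_cbal g ->
  (forall y, sphere y -> g y = 0) -> cbal x -> 1 / 4 <= dot x x ->
  (forall y, cbal y -> dot x x <= dot y y -> `|grad_dot qf g y| <= A) ->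
  `|g x| <= 2 * A * (1 - dot x x).
Proof.
move=> sg gs Bx x4 gA.
have A0 : 0 <= A by apply: le_trans (gA x Bx (lexx _)).
have [ox|sx] := cbal_obal_sphere Bx; last by rewrite gs// sx subrr mulr0 normr0.
pose r := Num.sqrt (dot x x).
have rr : r ^+ 2 = dot x x by rewrite sqr_sqrtr// dot_ge0.
have r0 : 0 <= r by exact: sqrtr_ge0.
have r2 : 1 / 2 <= r by clear - rr r0 x4; nra.
have r1 : r < 1 by move: ox; rewrite /obal /= -rr; clear - r0; nra.
pose e := r^-1 *: x.
have ee : dot e e = 1.
  by rewrite dotZ -rr exprVn mulVf// expf_neq0// gt_eqF//; lra.
have ete t : dot (0 + t *: e) (0 + t *: e) = t ^+ 2 by rewrite add0r dotZ ee mulr1.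
have ote t : t \in `]r, 1[ -> obal (0 + t *: e).
  rewrite in_itv /= => /andP[tr t1]; rewrite /obal /= ete.
  by rewrite expr_lt1//; lra.
have bte t : t \in `[r, 1] -> cbal (0 + t *: e).
  rewrite in_itv /= => /andP[tr t1]; rewrite /cbal /= ete.
  by rewrite expr_le1//; lra.
have dg t : t \in `]r, 1[ -> is_derive t 1 (fun s : R => g (0 + s *: e))
    ('D_e g (0 + t *: e)).
  move=> tI; apply: is_derive_line.
  have [U [oU Uy] [sU _]] := smooth_cbal_interior sg (ote t tI).
  exact: smooth_on_diff sU Uy.
have cg : {within `[r, 1], continuous (fun s : R => g (0 + s *: e))}.
  apply/subspace_continuousP => t tI.
  have := smooth_cbal_continuous sg; move/subspace_continuousP => /(_ _ (bte t tI)).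
  apply: cvg_trans => P /= nP.
  have ce : {for t, continuous (fun t : R => 0 + t *: e)}.
    apply: continuousD; first exact: cst_continuous.
    exact: continuousZr_tmp.
  have nc : nbhs t [set s : R | cbal (0 + s *: e) -> P (g (0 + s *: e))] := ce _ nP.
  by apply: (filterS _ nc) => s sP sI; apply: sP; exact: bte.
have [t tI E] := @MVT R _ _ r 1 r1 dg cg.
have re : 0 + r *: e = x by rewrite add0r scalerA mulfV ?scale1r// gt_eqF//; lra.
have ge1 : g (0 + 1 *: e) = 0 by apply: gs; rewrite /sphere /= ete expr1n.
have [U [oU Uy] [sU _]] := smooth_cbal_interior sg (ote t tI).
have tr : r < t by move: tI; rewrite in_itv /= => /andP[].
have t1 : t < 1 by move: tI; rewrite in_itv /= => /andP[].
have De : t * 'D_e g (0 + t *: e) = grad_dot qf g (0 + t *: e).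
  rewrite grad_dot_qfE; last exact/obalW/ote.
  rewrite deriveE_pderiv; last exact: smooth_on_diff sU Uy.
  rewrite mulr_sumr; apply: eq_bigr => i _.
  rewrite (bd_ext i oU Uy sU (fun _ _ _ => erefl) (obalW (ote t tI))).
  have -> : (0 + t *: e) 0 i = t * e 0 i by rewrite add0r mxE.
  exact: mulrA.
have Dle : `|'D_e g (0 + t *: e)| <= 2 * A.
  have : `|grad_dot qf g (0 + t *: e)| <= A.
    apply: gA; first exact/obalW/ote.
    by rewrite ete -rr; clear - tr r0; nra.
  rewrite -De normrM (@ger0_norm _ t); last by lra.
  have : r <= t by exact: ltW.
  by have := normr_ge0 ('D_e g (0 + t *: e)); move: (`|_|) => z; clear - r2; nra.
move: E; rewrite re ge1 sub0r => E.
rewrite -normrN E normrM.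
rewrite (@ger0_norm _ (1 - r)); last by lra.
have h1 : 1 - r <= 1 - dot x x by rewrite -rr; clear - r0 r1; nra.
apply: (@le_trans _ _ (2 * A * (1 - r))).
  by rewrite ler_wpM2r// subr_ge0 ltW.
by rewrite ler_wpM2l// mulr_ge0.
Qed.

(** With [a = n / 2 - 1] and [a = n / 2] this covers the constant function and
    the height function of the sphere, weighted as in [eigen_op]. *)
Lemma lap_expR_tau0 (a : R) x : cbal x ->
  qf x ^+ 2 * lap (fun y => expR (a * tau0 y)) x =
  expR (a * tau0 x) * (a * (1 + a) * (2 * qf x - 1) - a * N * qf x).
Proof.
move=> bx; have st := @smooth_tau0 R n.
rewrite (lapE (smooth_cbalZ a st) bx) (lapZ _ st bx).
rewrite (grad_dotZr _ _ st bx) grad_dotC (grad_dotZr _ _ st bx) (grad_dot_tau0_tau0 bx) (lap_tau0 bx).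
by field; rewrite gt_eqF// qf_gt0.
Qed.

(** The height [f] of the hemisphere, with the weight [E], vanishes on the
    boundary and lies in the kernel of [eigen_op]; hence [w = (f - eps) E] is
    a strict supersolution, positive on the smaller cap [f >= 2 eps]. If [v]
    is negative somewhere, the quotient of [v] by [w] has a negative minimum
    on that cap. By [radial_bound], applied twice, [v] is of the order of the
    square of the distance to the boundary, so for small [eps] the minimum is
    not on the rim [f = 2 eps], and an interior minimum contradicts the
    strictness. *)
Lemma eigen_supersolution_ge0 v : (2 <= n)%N -> smooth_cbal v ->
  (forall y, sphere y -> v y = 0) ->
  (forall y, sphere y -> grad_dot qf v y = 0) ->
  (forall y, obal y -> 0 <= eigen_op v y) ->
  forall y, cbal y -> 0 <= v y.
Proof.
move=> n2 sv vs vr lv y0 By0; rewrite leNgt; apply/negP => vy0.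
have N0 : 0 < N by rewrite ltr0n ltnW.
have oy0 : obal y0.
  by have [//|sy] := cbal_obal_sphere By0; move: vy0; rewrite vs// ltxx.
have st := @smooth_tau0 R n; have sq := @smooth_qf R n.
have sgv := smooth_grad_dot sq sv.
have [C C0 hC] := cbal_bound (smooth_grad_dot sq sgv).
have decay x : cbal x -> 1 / 4 <= dot x x ->
    `|v x| <= 4 * C * (1 - dot x x) ^+ 2.
  move=> Bx x4.
  have -> : 4 * C * (1 - dot x x) ^+ 2 =
    2 * (2 * C * (1 - dot x x)) * (1 - dot x x) by ring.
  apply: radial_bound => // y By xy.
  apply: (@le_trans _ _ (2 * C * (1 - dot y y))).
    apply: radial_bound => //; first exact: le_trans xy.
    by move=> z Bz _; exact: hC.
  by rewrite ler_wpM2l ?mulr_ge0// lerB.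
pose c := (N - 2) / 2.
pose f y := expR (tau0 y) - 1.
pose E y := expR (c * tau0 y).
have sf : smooth_cbal f.
  by apply: smooth_cbalB; [exact: smooth_cbal_expR|exact: smooth_cbalC].
have sE : smooth_cbal E by apply: smooth_cbal_expR; exact: smooth_cbalZ.
have fE y : f y * (2 * qf y) = 1 - dot y y.
  rewrite /f expR_tau0 mulrBl mul1r mulrCA mulVf ?gt_eqF ?qf_gt0//.
  by rewrite /qf; field.
have q2 (y : 'rV[R]_n) : 1 / 2 <= qf y by rewrite /qf; have := dot_ge0 y; lra.
have E0 y : 0 < E y by exact: expR_gt0.
have fpos y : obal y -> 0 < f y.
  move=> oy; have : 0 < f y * (2 * qf y) by rewrite fE subr_gt0.
  by rewrite pmulr_lgt0// mulr_gt0// qf_gt0.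
have f0 := fpos y0 oy0.
pose t1 := - v y0 / (f y0 * E y0).
have fE0 : 0 < f y0 * E y0 by rewrite mulr_gt0.
have t10 : 0 < t1 by rewrite divr_gt0// oppr_gt0.
have C1 : 0 < 64 * C + 1 by lra.
(* below [f y0 / 4] so that [y0] lies in the cap, [1 / 8] so that [decay] applies
   on the rim, and the last bound keeps the quotient on the rim above [- t1] *)
pose eps := Num.min (f y0 / 4) (Num.min (1 / 8) (t1 / (2 * (64 * C + 1)))) : R.
have eps0 : 0 < eps.
  by rewrite !lt_min; apply/and3P; split; [lra|lra|rewrite divr_gt0// mulr_gt0].
have eps1 : eps <= f y0 / 4 by rewrite ge_min lexx.
have eps2 : eps <= 1 / 8 by rewrite !ge_min lexx orbT.
have eps3 : 64 * C * eps < t1.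
  have : eps <= t1 / (2 * (64 * C + 1)) by rewrite !ge_min lexx !orbT.
  rewrite ler_pdivlMr ?mulr_gt0//.
  have : 0 <= C * eps by rewrite mulr_ge0// ltW.
  have -> : eps * (2 * (64 * C + 1)) = 128 * (C * eps) + 2 * eps by ring.
  by rewrite -mulrA; move: (C * eps) eps0 => z; clear; lra.
clearbody eps.
pose w y := (f y - eps) * E y.
have sw : smooth_cbal w.
  by apply: smooth_cbalM => //; apply: smooth_cbalB => //; exact: smooth_cbalC.
pose K := [set y : 'rV[R]_n | cbal y /\ 2 * eps - f y <= 0].
have sK : smooth_cbal (fun y => 2 * eps - f y).
  by apply: smooth_cbalB => //; exact: smooth_cbalC.
have w0 y : K y -> 0 < w y by move=> [_ fy]; rewrite mulr_gt0//; lra.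
have Ky0 : K y0 by split => //; lra.
have cr : {within K, continuous (fun y => v y * (w y)^-1)}.
  have sub g : smooth_cbal g -> {within K, continuous g}.
    by move=> sg; apply: continuous_subspaceW (smooth_cbal_continuous sg) => y [].
  apply/subspace_continuousP => y Ky.
  apply: cvgM.
    by have := sub v sv; move/subspace_continuousP; exact.
  apply: cvgV; first by rewrite gt_eqF// w0.
  by have := sub w sw; move/subspace_continuousP; exact.
have [x1] := EVT_min_rV (ex_intro _ y0 Ky0) (sublevel_compact sK) cr.
rewrite inE => Kx1 x1m.
have [Bx1 fx1] := Kx1.
pose t := - (v x1 * (w x1)^-1).
have tt1 : t1 <= t.
  rewrite /t lerNr; have := x1m y0; rewrite inE => /(_ Ky0) /le_trans; apply.
  rewrite /t1 mulNr opprK; apply: ler_wnM2l; first exact: ltW.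
  rewrite lef_pV2 ?posrE ?w0//.
  by rewrite /w ler_wpM2r ?(ltW (E0 _))// gerBl ltW.
have vx1 : v x1 = - t * w x1.
  by rewrite /t opprK divfK// gt_eqF// w0.
have t0 : 0 < t by exact: lt_le_trans tt1.
have E1 : 1 <= E x1.
  rewrite /E -expR0 ler_expR mulr_ge0//.
    by rewrite /c divr_ge0// subr_ge0 (ler_nat R 2 n).
  rewrite -ler_expR expR0 expR_tau0 -[leLHS]invr1 lef_pV2 ?posrE ?qf_gt0//.
  exact: qf_le1.
have fx1' : 2 * eps < f x1.
  rewrite lt_neqAle -subr_le0 fx1 andbT; apply/eqP => fe.
  have th : 1 - dot x1 x1 <= 4 * eps.
    rewrite -fE -fe; have := qf_le1 Bx1; have := q2 x1.
    by move: (qf x1) => z; clear - eps0; nra.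
  have x4 : 1 / 4 <= dot x1 x1 by clear - th eps2; lra.
  have wx : w x1 = eps * E x1 by rewrite /w -fe; ring.
  have lo : t1 * eps <= `|v x1|.
    rewrite vx1 mulNr normrN normrM !gtr0_norm ?w0// wx.
    rewrite ler_pM ?(ltW t10) ?(ltW eps0)//.
    by rewrite ler_peMr// ltW.
  have up : (1 - dot x1 x1) ^+ 2 <= (4 * eps) ^+ 2.
    rewrite ler_pXn2r// ?nnegrE ?subr_ge0// mulr_ge0//; exact: ltW.
  have : t1 * eps <= 4 * C * (4 * eps) ^+ 2.
    apply: (le_trans lo); apply: (le_trans (decay x1 Bx1 x4)).
    by rewrite ler_wpM2l// mulr_ge0.
  have -> : 4 * C * (4 * eps) ^+ 2 = 64 * C * eps * eps by ring.
  by rewrite ler_pM2r// leNgt eps3.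
have ox1 : obal x1.
  rewrite /obal /= -subr_gt0 -fE; apply: mulr_gt0; last by rewrite mulr_gt0// qf_gt0.
  by apply: lt_trans fx1'; rewrite mulr_gt0.
pose u y := v y + t * w y.
have stw : smooth_cbal (fun y => t * w y) by exact: smooth_cbalZ.
have su : smooth_cbal u by exact: smooth_cbalD.
have : 0 <= lap u x1.
  apply: lap_local_min => //.
  have cf : {for x1, continuous f}.
    have [U [oU Uy] [sU _]] := smooth_cbal_interior sf ox1.
    exact: smooth_on_continuous sU Uy.
  have nob : \forall z \near x1, obal z.
    exact: open_nbhs_nbhs (conj obal_open ox1).
  have nf : \forall z \near x1, 2 * eps < f z by exact: near_gtr.
  apply: filterS2 nob nf => z oz fz.
  have Kz : K z by split; [exact: obalW|rewrite subr_le0 ltW].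
  have := x1m z; rewrite inE => /(_ Kz).
  have -> : v x1 / w x1 = - t by rewrite /t opprK.
  rewrite ler_pdivlMr ?w0// /u vx1 !mulNr addNr.
  by move: (t * w z) => a; lra.
have wE y : w y = expR ((c + 1) * tau0 y) - (1 + eps) * expR (c * tau0 y).
  have -> : (c + 1) * tau0 y = c * tau0 y + tau0 y by ring.
  by rewrite /w /f /E expRD; ring.
have lapw : qf x1 ^+ 2 * lap w x1 = - (N * (N + 2) / 4 * w x1 + eps * N * E x1).
  have s1 : smooth_cbal (fun y : 'rV[R]_n => expR ((c + 1) * tau0 y)).
    by apply: smooth_cbal_expR; exact: smooth_cbalZ.
  transitivity (qf x1 ^+ 2 * lap (fun y => expR ((c + 1) * tau0 y) + (- (1 + eps)) * E y) x1).
    by congr (_ * _); apply: lap_eq => y _; rewrite wE mulNr.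
  rewrite (lapD s1 (smooth_cbalZ _ sE) Bx1) (lapZ _ sE Bx1) mulrDr mulrCA.
  rewrite !lap_expR_tau0// wE /E.
  have -> : expR ((c + 1) * tau0 x1) = expR (c * tau0 x1) / qf x1.
    have -> : (c + 1) * tau0 x1 = c * tau0 x1 + tau0 x1 by ring.
    by rewrite expRD expR_tau0.
  by rewrite /c; field; rewrite gt_eqF// qf_gt0.
have lapu : lap u x1 = lap v x1 + t * lap w x1.
  by rewrite (lapD sv stw Bx1) (lapZ _ sw Bx1).
rewrite leNgt => /negP; apply.
have q20 : 0 < qf x1 ^+ 2 by rewrite exprn_gt0// qf_gt0.
rewrite -(pmulr_rlt0 _ q20) lapu mulrDr mulrCA lapw.
have := lv x1 ox1; rewrite /eigen_op -expr2 vx1.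
have : 0 < t * (eps * N * E x1) by rewrite !mulr_gt0.
move: (qf x1 ^+ 2 * lap v x1) => X pos l1.
have -> : X + t * - (N * (N + 2) / 4 * w x1 + eps * N * E x1) =
  - (- X - N * (N + 2) / 4 * (- t * w x1)) - t * (eps * N * E x1) by ring.
by lra.
Qed.

End BallRigidity.

(** * Rigidity on the ball *)

Section Psi.
Context {R : realType}.
Implicit Types k a t s : R.

Lemma is_derive_expRZ k s : is_derive s 1 (fun t => expR (k * t)) (k * expR (k * s)).
Proof.
have dk : is_derive s 1 (fun t : R => k * t) k.
  apply: is_derive_eq (is_deriveZ k (is_derive_id s 1)) _.
  by rewrite /GRing.scale /= mulr1.
apply: DeriveDef.
  apply/derivable1_diffP; apply: (@differentiable_comp _ _ _ _ (fun t => k * t) expR).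
    exact/derivable1_diffP/ex_derive.
  exact/derivable1_diffP/ex_derive.
rewrite -derive1E (@derive1_comp _ (fun t => k * t) expR); last 2 first.
- exact: ex_derive.
- exact: ex_derive.
by rewrite !derive1E !derive_val mulrC.
Qed.

Lemma is_derive_psi k s : is_derive s 1 (psi k) (expR (k * s)).
Proof.
have [->|k0] := eqVneq k 0.
  rewrite mul0r expR0 (_ : psi 0 = id); first exact: is_derive_id.
  by apply/funext => t; rewrite /psi eqxx.
have -> : psi k = k^-1 \*: (fun t => expR (k * t) - 1).
  by apply/funext => t; rewrite /psi (negbTE k0) /GRing.scale /= mulrC.
have -> : expR (k * s) = k^-1 *: (k * expR (k * s) - 0).
  by rewrite subr0 /GRing.scale /= mulKf.
by apply: is_deriveZ; apply: is_deriveB; exact: is_derive_expRZ.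
Qed.

Lemma psi_inj k : injective (psi k).
Proof.
move=> s t; rewrite /psi; case: eqVneq => // k0.
move=> /(congr1 (fun z => z * k)); rewrite !divfK// => /addIr /expR_inj.
exact: mulfI.
Qed.

(** The difference of the two sides, as a function of [t], has derivative [(k
    + 4) expR (k t) (expR (4 t) - expR (4 a))], so its minimum is at [t = a]. *)
Lemma psi_convex k a t : 0 <= k + 4 ->
  (k + 4) * expR (4 * a) * (psi k t - psi k a) <=
  expR ((k + 4) * t) - expR ((k + 4) * a).
Proof.
move=> k4.
pose F s := expR ((k + 4) * s) - (k + 4) * expR (4 * a) * psi k s.
pose F' s := (k + 4) * expR (k * s) * (expR (4 * s) - expR (4 * a)).
have dF s : is_derive s 1 F (F' s).
  have -> : F' s = (k + 4) * expR ((k + 4) * s) - ((k + 4) * expR (4 * a)) *: expR (k * s).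
    have -> : (k + 4) * s = k * s + 4 * s by ring.
    by rewrite /F' expRD /GRing.scale /=; ring.
  apply: is_deriveB; first exact: is_derive_expRZ.
  exact: (is_deriveZ _ (is_derive_psi k s)).
have cF (u w : R) : {within `[u, w], continuous F}.
  by apply: derivable_within_continuous => s _; exact: ex_derive.
suff : F a <= F t by rewrite /F mulrBr; lra.
have [ta|at_|->//] := ltgtP t a.
  have [s sI E] := MVT ta (fun s _ => dF s) (cF t a).
  rewrite -subr_le0 E mulr_le0_ge0//; last by rewrite subr_ge0 ltW.
  rewrite /F' mulr_ge0_le0 ?mulr_ge0 ?expR_ge0// subr_le0 ler_expR ler_pM2l//.
  by move: sI; rewrite in_itv /= => /andP[_ /ltW].
have [s sI E] := MVT at_ (fun s _ => dF s) (cF a t).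
rewrite -subr_ge0 E; apply: mulr_ge0; last by rewrite subr_ge0 ltW.
rewrite /F' !mulr_ge0// ?expR_ge0// subr_ge0 ler_expR ler_pM2l//.
by move: sI; rewrite in_itv /= => /andP[/ltW].
Qed.

End Psi.

Section BallTheorem.
Context {R : realType} {n : nat}.
Variables (G : 'rV[R]_n -> 'M[R]_n) (tau : 'rV[R]_n -> R).
Local Notation N := (n%:R : R).
Local Notation k := ((N - 4) / 2).
Hypothesis n3 : (3 <= n)%N.
Hypothesis stau : smooth_cbal tau.
Hypothesis Gtau : forall x, cbal x -> G x = (expR (2 * tau x))%:M.
Hypothesis Qge : forall x, cbal x -> N * (N ^+ 2 - 4) / 8 <= Qcurv G x.
Hypothesis tau_bd : forall x, sphere x -> tau x = 0.
Hypothesis dtau_bd : forall x, sphere x -> grad_dot qf tau x = -1.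
Hypothesis scal_bd : forall x, sphere x -> N * (N - 1) <= scalar_curv G x.

Let V y := psi k (tau y) - psi k (tau0 y).
Let v y := V y * expR (tau0 y).

Let st0 : smooth_cbal (@tau0 R n) := smooth_tau0.

Lemma smooth_V : smooth_cbal V.
Proof. by apply: smooth_cbalB; exact: smooth_psi. Qed.

Lemma smooth_v : smooth_cbal v.
Proof. by apply: smooth_cbalM smooth_V _; exact: smooth_cbal_expR. Qed.

Lemma lapV x : cbal x -> lap V x = lap (fun y => psi k (tau y)) x - lap (fun y => psi k (tau0 y)) x.
Proof.
move=> bx; exact: (lapB (smooth_psi k stau) (smooth_psi k st0) bx).
Qed.

(** The inequality [Q_g >= Q_0], made linear in [V] by [psi_convex]. *)
Lemma bilaplacian_V_ge x : cbal x ->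
  N * (N + 4) * (N ^+ 2 - 4) / 16 * expR (4 * tau0 x) * V x <= lap (lap V) x.
Proof.
move=> bx; have n3' : 3 <= N by exact: natr_ge3.
have s1 := smooth_lap (smooth_psi k stau); have s2 := smooth_lap (smooth_psi k st0).
have -> : lap (lap V) x = lap (lap (fun y => psi k (tau y))) x - lap (lap (fun y => psi k (tau0 y))) x.
  by rewrite -(lapB s1 s2 bx); apply: lap_eq => y; exact: lapV.
rewrite (bilaplacian_psi n3 stau Gtau bx).
pose G0 (y : 'rV[R]_n) : 'M[R]_n := (expR (2 * tau0 y))%:M.
have G0E y : cbal y -> G0 y = (expR (2 * tau0 y))%:M by [].
rewrite (bilaplacian_psi n3 st0 G0E bx) (round_Qcurv n3 G0E bx).
have k4 : 0 <= k + 4 by lra.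
have := psi_convex (tau0 x) (tau x) k4; rewrite -/(V x).
have Q0 : 0 <= N * (N ^+ 2 - 4) / 8.
  by rewrite divr_ge0// mulr_ge0//; nra.
move=> /(ler_wpM2l Q0) => cv.
have : N * (N ^+ 2 - 4) / 8 * expR ((k + 4) * tau x) <= Qcurv G x * expR ((k + 4) * tau x).
  by rewrite ler_wpM2r ?expR_ge0// Qge.
move: cv; rewrite [X in _ <= X -> _]mulrBr.
have -> : N * (N ^+ 2 - 4) / 8 * ((k + 4) * expR (4 * tau0 x) * V x) =
  N * (N + 4) * (N ^+ 2 - 4) / 16 * expR (4 * tau0 x) * V x by field.
lra.
Qed.

Lemma boundary_data x : sphere x ->
  [/\ qf x = 1, tau0 x = 0, V x = 0 & grad_dot qf V x = 0].
Proof.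
move=> sx; have bx : cbal x by rewrite /cbal /= sx.
have q1 : qf x = 1 by rewrite /qf sx; field.
have t0 : tau0 x = 0 by rewrite /tau0 q1 ln1 oppr0.
split => //; first by rewrite /V tau_bd// t0 subrr.
have -> : grad_dot qf V x = grad_dot qf tau x - grad_dot qf tau0 x.
  rewrite /grad_dot -sumrB; apply: eq_bigr => i _.
  rewrite (bdB i (smooth_psi k stau) (smooth_psi k st0) bx).
  rewrite (bd_psi _ i stau bx) (bd_psi _ i st0 bx) tau_bd// t0 mulr0 expR0.
  by rewrite !mul1r mulrBr.
rewrite dtau_bd// (grad_dot_tau0 _ bx) (grad_dot_qf_qf bx) q1.
by field.
Qed.

Lemma v_sphere x : sphere x -> v x = 0.
Proof. by move=> sx; rewrite /v; have [_ _ -> _] := boundary_data sx; rewrite mul0r. Qed.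

Lemma grad_dot_v_sphere x : sphere x -> grad_dot qf v x = 0.
Proof.
move=> sx; have bx : cbal x by rewrite /cbal /= sx.
rewrite (grad_dotMr _ smooth_V (smooth_cbal_expR st0) bx).
by have [_ _ -> ->] := boundary_data sx; rewrite mul0r mulr0 addr0.
Qed.

(** The squared gradient dominates the square of the radial component, which
    is [-1]. *)
Lemma grad_dot_tau_ge1 x : sphere x -> 1 <= grad_dot tau tau x.
Proof.
move=> sx; have bx : cbal x by rewrite /cbal /= sx.
have : 0 <= \sum_i (bd i tau x + x 0 i) ^+ 2 by apply: sumr_ge0 => i _; exact: sqr_ge0.
have -> : \sum_i (bd i tau x + x 0 i) ^+ 2 = grad_dot tau tau x + 2 * grad_dot qf tau x + dot x x.
  rewrite (grad_dot_qfE _ bx) /grad_dot /dot mulr_sumr -!big_split /=; apply: eq_bigr => i _.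
  by ring.
by rewrite dtau_bd// sx; lra.
Qed.

(** On the sphere [eigen_op v] is minus the Laplacian of [V], since [v], [V]
    and the radial derivative of [V] vanish there. The scalar curvature bound
    controls [lap tau + (k + 1) |grad tau|^2]; the excess [|grad tau|^2 - 1]
    has the good sign. *)
Lemma eigen_op_v_sphere x : sphere x -> 0 <= eigen_op v x.
Proof.
move=> sx; have bx : cbal x by rewrite /cbal /= sx.
have n3' : 3 <= N by exact: natr_ge3.
have [q1 t0 V0 gV] := boundary_data sx.
rewrite /eigen_op v_sphere// q1 mulr0 subr0 !mul1r oppr_ge0.
rewrite (lapM smooth_V (smooth_cbal_expR st0) bx) V0 mul0r add0r.
rewrite (grad_dotEr _ st0 bx) (grad_dot_tau0 _ bx) [grad_dot V qf x]grad_dotC gV t0 expR0 !mul0r oppr0 !mulr0 addr0 mul1r.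
rewrite (lapV bx) (lap_psi _ stau bx) (lap_psi _ st0 bx) tau_bd// t0 mulr0 expR0 !mul1r.
rewrite (lap_tau0 bx) (grad_dot_tau0_tau0 bx) q1.
have := scal_bd sx; have := conformal_Jcurv n3 stau Gtau bx.
rewrite /Jcurv /flatJ tau_bd// mulr0 oppr0 expR0 mul1r => E.
have D0 : 0 < 2 * (N - 1) by lra.
have := grad_dot_tau_ge1 sx.
have -> : scalar_curv G x = 2 * (N - 1) * - (lap tau x + (k + 1) * grad_dot tau tau x).
  by rewrite -E mulrC divfK// gt_eqF.
move=> p1; have -> : N * (N - 1) = 2 * (N - 1) * (N / 2) by field.
rewrite ler_pM2l//.
have -> : (2 * 1 - 1) / 1 ^+ 2 - N / 1 + k * ((2 * 1 - 1) / 1 ^+ 2) = 1 - N + k :> R by field.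
lra.
Qed.

Lemma eigen_op_v_ge0 x : cbal x -> 0 <= eigen_op v x.
Proof.
have n3' : 3 <= N by exact: natr_ge3.
apply: min_principle; [exact: smooth_eigen_op smooth_v|exact: eigen_op_v_sphere|].
move=> {}x ox lx; have bx := obalW ox.
have := paneitz_factor smooth_v bx.
have q0 := qf_gt0 x.
have qv y : qf y * v y = V y.
  by rewrite /v expR_tau0 mulrCA mulfV ?mulr1// gt_eqF// qf_gt0.
have E y : cbal y -> lap (fun y => qf y * v y) y = lap V y.
  by move=> _; apply: lap_eq => z _; exact: qv.
rewrite (lap_eq x E) => P.
have B := bilaplacian_V_ge bx.
have q3 : 0 <= qf x ^+ 3 by rewrite exprn_ge0// ltW.
have := ler_wpM2l q3 B.
have -> : qf x ^+ 3 * (N * (N + 4) * (N ^+ 2 - 4) / 16 * expR (4 * tau0 x) * V x) =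
    (N + 4) * (N - 2) / 4 * (N * (N + 2) / 4) * v x.
  have -> : expR (4 * tau0 x) = (qf x)^-1 ^+ 4 by rewrite expRM_natl expR_tau0.
  rewrite /v expR_tau0; field.
  by rewrite gt_eqF.
move=> B'.
have M0 : 0 < (N + 4) * (N - 2) / 4 by rewrite divr_gt0// mulr_gt0//; lra.
have : (N + 4) * (N - 2) / 4 * eigen_op v x < 0 by rewrite pmulr_rlt0.
have q2 : 0 < qf x ^+ 2 by rewrite exprn_gt0.
rewrite -(pmulr_rlt0 (lap (eigen_op v) x) q2).
move: P B'.
move: (_ * eigen_op v x) (qf x ^+ 3 * _) (_ * v x) (qf x ^+ 2 * _) => a b c d.
lra.
Qed.

Theorem ball_rigidity x : cbal x -> tau x = tau0 x.
Proof.
move=> bx; have n3' : 3 <= N by exact: natr_ge3.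
have v0 : forall y, cbal y -> 0 <= v y.
  apply: eigen_supersolution_ge0; [exact: ltnW|exact: smooth_v|exact: v_sphere| |].
    exact: grad_dot_v_sphere.
  by move=> y /obalW; exact: eigen_op_v_ge0.
have vx : v x = 0.
  apply: superharmonic_eq0 bx => //.
  - exact: leq_trans n3.
  - exact: smooth_v.
  - move=> y oy; have := eigen_op_v_ge0 (obalW oy); have := v0 y (obalW oy).
    have q2 : 0 < qf y * qf y by rewrite mulr_gt0// qf_gt0.
    rewrite /eigen_op -(pmulr_rle0 _ q2) => vy.
    have : 0 <= N * (N + 2) / 4 * v y.
      by rewrite mulr_ge0// divr_ge0// mulr_ge0//; lra.
    by move: (_ * v y) (_ * lap v y) => a b; lra.
  - exact: v_sphere.
  - exact: grad_dot_v_sphere.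
move/eqP: vx; rewrite /v mulf_eq0 (gt_eqF (expR_gt0 _)) orbF subr_eq0 => /eqP.
exact: psi_inj.
Qed.

End BallTheorem.

(** * The stereographic chart *)

Section Chart.
Context {R : realType} {n : nat}.
Implicit Types (x y : 'rV[R]_n) (p u w : 'rV[R]_(n + 1)).
Local Notation N := (n%:R : R).

Lemma lsubmxE u j : lsubmx u 0 j = u 0 (lshift 1 j).
Proof. by rewrite mxE. Qed.

Lemma dot_split u w :
  dot u w = dot (lsubmx u) (lsubmx w) + height u * height w.
Proof.
rewrite /dot big_split_ord /= big_ord1; congr (_ + _).
by apply: eq_bigr => i _; rewrite !lsubmxE.
Qed.

Lemma stereo_l x j : stereo x 0 (lshift 1 j) = x 0 j * expR (tau0 x).
Proof.
rewrite /stereo mxE row_mxEl mxE expR_tau0 /qf.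
by field; rewrite gt_eqF//; have := dot_ge0 x; lra.
Qed.

Lemma stereo_r x : stereo x 0 (rshift n ord0) = expR (tau0 x) - 1.
Proof.
rewrite /stereo mxE row_mxEr mxE eqxx expR_tau0 /qf /=.
by field; rewrite gt_eqF//; have := dot_ge0 x; lra.
Qed.

Lemma lsubmx_stereo x : lsubmx (stereo x) = (qf x)^-1 *: x.
Proof. by apply/rowP => j; rewrite lsubmxE stereo_l expR_tau0 mxE mulrC. Qed.

Lemma height_stereo x : height (stereo x) = (qf x)^-1 - 1.
Proof. by rewrite /height stereo_r expR_tau0. Qed.

Lemma dot_qf x : dot x x = 2 * qf x - 1.
Proof. by rewrite /qf; field. Qed.

Lemma stereo_unit x : dot (stereo x) (stereo x) = 1.
Proof.
rewrite dot_split lsubmx_stereo height_stereo dotZ dot_qf.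
by field; rewrite gt_eqF// qf_gt0.
Qed.

Lemma stereo_hemisphere x : cbal x -> hemisphere (stereo x).
Proof.
move=> bx; split; first exact: stereo_unit.
rewrite height_stereo subr_ge0 -[leLHS]invr1 lef_pV2 ?posrE ?qf_gt0//.
exact: qf_le1.
Qed.

Lemma stereo_equator x : sphere x -> equator (stereo x).
Proof.
move=> sx; split; first exact: stereo_unit.
by rewrite height_stereo /qf sx; field.
Qed.

Lemma stereoK x : chart (stereo x) = x.
Proof.
rewrite /chart height_stereo lsubmx_stereo addrC subrK invrK scalerA.
by rewrite mulfV ?scale1r// gt_eqF// qf_gt0.
Qed.

Lemma qf_chart p : hemisphere p -> qf (chart p) = (1 + height p)^-1.
Proof.
move=> [up hp]; rewrite /qf /chart dotZ.
have : dot (lsubmx p) (lsubmx p) = 1 - height p ^+ 2.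
  by rewrite -up dot_split expr2 addrK.
move=> ->; field; rewrite gt_eqF//; lra.
Qed.

Lemma chart_cbal p : hemisphere p -> cbal (chart p).
Proof.
move=> hp; rewrite /cbal /= dot_qf qf_chart//.
have [_ h0] := hp.
have : (1 + height p)^-1 <= 1 by rewrite invf_le1; lra.
by lra.
Qed.

Lemma chartK p : hemisphere p -> stereo (chart p) = p.
Proof.
move=> hp; have [_ h0] := hp.
have hp1 : 1 + height p != 0 by rewrite gt_eqF//; lra.
rewrite -[RHS]hsubmxK -[LHS]hsubmxK; congr row_mx.
  by rewrite lsubmx_stereo qf_chart// invrK /chart scalerA mulfV// scale1r.
apply/rowP => i; rewrite (ord1 i) mxE [RHS]mxE.
transitivity (height (stereo (chart p))); first by [].
by rewrite height_stereo qf_chart// invrK addrC addKr.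
Qed.

Lemma smooth_onT_expR_tau0 : smooth_on setT (fun y : 'rV[R]_n => expR (tau0 y)).
Proof.
have sd : smooth_on setT (fun y : 'rV[R]_n => dot y y) by exact: smooth_dot openT.
apply/smooth_onP => k; apply: (Ck_expR openT).
have c1 : Ck k setT (fun y : 'rV[R]_n => ln (qf y)).
  apply: (Ck_ln openT) => [y _|]; first exact: qf_gt0.
  apply: (CkM openT (CkD openT _ _)); try exact: CkC.
  exact: (smooth_onP _ _).1.
by apply: (Ck_eq openT _ (CkM openT (@CkC _ _ k setT (-1)) c1)) => y _; rewrite mulN1r.
Qed.

Lemma smooth_onT_pderiv (f : 'rV[R]_n -> R) i x : smooth_on setT f -> cbal x ->
  pderiv i f x = bd i f x.
Proof.
by move=> sf bx; rewrite (bd_ext i openT I sf (fun _ _ _ => erefl) bx).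
Qed.

Lemma smooth_stereo_l j : smooth_on setT (fun y => stereo y 0 (lshift 1 j)).
Proof.
apply/smooth_onP => k.
apply: (Ck_eq openT _ (CkM openT (Ck_coord j)
  ((smooth_onP _ _).1 smooth_onT_expR_tau0 k))) => y _.
by rewrite stereo_l.
Qed.

Lemma smooth_stereo_r : smooth_on setT (fun y => stereo y 0 (rshift n ord0)).
Proof.
apply/smooth_onP => k.
apply: (Ck_eq openT _ (CkD openT ((smooth_onP _ _).1 smooth_onT_expR_tau0 k)
  (@CkC _ _ k setT (-1)))) => y _.
by rewrite stereo_r.
Qed.

Lemma derivable_stereo x v : derivable (@stereo R n) x v.
Proof.
apply/derivable_mxP => i j; rewrite (ord1 i); case: (split_ordP j) => l ->.
  exact/diff_derivable/(smooth_on_diff (smooth_stereo_l l)).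
rewrite (ord1 l); exact/diff_derivable/(smooth_on_diff smooth_stereo_r).
Qed.

Lemma derive_stereo_l i j x : cbal x ->
  ('D_(delta_mx 0 i) (@stereo R n) x) 0 (lshift 1 j) =
  (i == j)%:R / qf x - x 0 i * x 0 j / qf x ^+ 2.
Proof.
move=> bx; rewrite derive_mx; last exact: derivable_stereo.
rewrite mxE -/(pderiv i (fun y => stereo y 0 (lshift 1 j)) x).
rewrite (smooth_onT_pderiv _ (smooth_stereo_l j) bx).
have sc : smooth_cbal (fun y : 'rV[R]_n => y 0 j) by exact: smooth_cbal_coord.
have st := @smooth_tau0 R n.
transitivity (bd i (fun y => y 0 j * expR (tau0 y)) x).
  by apply: bd_eq => y _; rewrite stereo_l.
rewrite (bdM i sc (smooth_cbal_expR st) bx) (bd_coord j i bx) (bd_expR i st bx).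
rewrite bd_tau0// expR_tau0.
by field; rewrite gt_eqF// qf_gt0.
Qed.

Lemma derive_stereo_r i x : cbal x ->
  height ('D_(delta_mx 0 i) (@stereo R n) x) = - (x 0 i / qf x ^+ 2).
Proof.
move=> bx; rewrite /height derive_mx; last exact: derivable_stereo.
rewrite mxE -/(pderiv i (fun y => stereo y 0 (rshift n ord0)) x).
rewrite (smooth_onT_pderiv _ smooth_stereo_r bx).
have st := @smooth_tau0 R n.
transitivity (bd i (fun y => expR (tau0 y) - 1) x).
  by apply: bd_eq => y _; rewrite stereo_r.
rewrite (bdB i (smooth_cbal_expR st) (smooth_cbalC 1) bx) (bdC _ _ bx).
rewrite (bd_expR i st bx) bd_tau0// expR_tau0.
by field; rewrite gt_eqF// qf_gt0.
Qed.

Lemma stereo_tangent i x : cbal x ->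
  tangent (stereo x) ('D_(delta_mx 0 i) (@stereo R n) x).
Proof.
move=> bx; rewrite /tangent dot_split derive_stereo_r// height_stereo lsubmx_stereo.
have -> : dot ((qf x)^-1 *: x) (lsubmx ('D_(delta_mx 0 i) (@stereo R n) x)) =
    x 0 i / qf x ^+ 2 - x 0 i / qf x ^+ 3 * dot x x.
  rewrite /dot (eq_bigr (fun j => (i == j)%:R * (x 0 j / qf x ^+ 2)
     - x 0 i / qf x ^+ 3 * (x 0 j * x 0 j))).
    by rewrite sumrB sum_deltar -mulr_sumr.
  move=> j _; rewrite mxE lsubmxE derive_stereo_l//.
  by field; rewrite gt_eqF// qf_gt0.
by rewrite dot_qf; field; rewrite gt_eqF// qf_gt0.
Qed.

(** Stereographic projection is conformal. *)
Lemma stereo_conformal i j x : cbal x ->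
  dot ('D_(delta_mx 0 i) (@stereo R n) x) ('D_(delta_mx 0 j) (@stereo R n) x) =
  (i == j)%:R / qf x ^+ 2.
Proof.
move=> bx; pose D a := 'D_(delta_mx 0 a) (@stereo R n) x.
have Dl a b : D a 0 (lshift 1 b) =
  (a == b)%:R / qf x - x 0 a * x 0 b / qf x ^+ 2 by exact: derive_stereo_l.
have Dr a : height (D a) = - (x 0 a / qf x ^+ 2) by exact: derive_stereo_r.
rewrite -/(D i) -/(D j); clearbody D.
rewrite dot_split !Dr /dot (eq_bigr (fun l => (i == l)%:R * ((j == l)%:R / qf x ^+ 2 - x 0 j * x 0 l / qf x ^+ 3)
   - ((j == l)%:R * (x 0 i * x 0 l / qf x ^+ 3) - x 0 i * x 0 j / qf x ^+ 4 * (x 0 l * x 0 l)))).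
  rewrite !sumrB !sum_deltar -mulr_sumr -/(dot x x) dot_qf eq_sym.
  by field; rewrite gt_eqF// qf_gt0.
move=> l _; rewrite !lsubmxE !Dl.
by field; rewrite gt_eqF// qf_gt0.
Qed.

End Chart.

(** * Boundary conditions and the hemisphere *)

Section Rotation.
Context {R : realType} {n : nat}.
Implicit Types (x y : 'rV[R]_n).

(** A linear Killing field: in the proofs below it is a tangent field of the
    sphere, smooth on the ball, whose covariant derivative along itself is
    explicit. *)
Definition rotation (i j : 'I_n) (y : 'rV[R]_n) : 'rV[R]_n :=
  \row_l (y 0 j * (i == l)%:R - y 0 i * (j == l)%:R).

Lemma smooth_rotation i j : smooth_vfield (rotation i j).
Proof.
move=> l; have sc a := @smooth_cbal_coord R n a.
apply: (smooth_cbal_eq _ (smooth_cbalB (smooth_cbalM (sc j) (smooth_cbalC (i == l)%:R))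
   (smooth_cbalM (sc i) (smooth_cbalC (j == l)%:R)))) => y _.
by rewrite mxE.
Qed.

Lemma dot_rotation i j x u :
  dot u (rotation i j x) = x 0 j * u 0 i - x 0 i * u 0 j.
Proof.
rewrite /dot (eq_bigr (fun l => (i == l)%:R * (x 0 j * u 0 l) - (j == l)%:R * (x 0 i * u 0 l))).
  by rewrite sumrB !sum_deltar.
by move=> l _; rewrite mxE; ring.
Qed.

Lemma rotation_tangent i j : tangent_to_boundary (rotation i j).
Proof. by move=> x _; rewrite dot_rotation mulrC subrr. Qed.

Lemma rotation_sqr i j x : i != j ->
  dot (rotation i j x) (rotation i j x) = x 0 i ^+ 2 + x 0 j ^+ 2.
Proof.
move=> ij; rewrite dot_rotation !mxE !eqxx (negbTE ij) eq_sym (negbTE ij) /=.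
by ring.
Qed.

Lemma bd_rotation a i j l x : cbal x ->
  bd a (fun y => rotation i j y 0 l) x =
  (a == j)%:R * (i == l)%:R - (a == i)%:R * (j == l)%:R.
Proof.
move=> bx; have sc b := @smooth_cbal_coord R n b.
transitivity (bd a (fun y => (i == l)%:R * y 0 j - (j == l)%:R * y 0 i) x).
  by apply: bd_eq => y _; rewrite mxE mulrC [X in _ - X]mulrC.
rewrite (bdB a (smooth_cbalZ _ (sc j)) (smooth_cbalZ _ (sc i)) bx).
rewrite (bdZ _ a (sc j) bx) (bdZ _ a (sc i) bx) !bd_coord//.
by rewrite mulrC [X in _ - X]mulrC.
Qed.

Lemma sphere_rotation x : (2 <= n)%N -> sphere x ->
  exists i j : 'I_n, i != j /\ 0 < x 0 i ^+ 2 + x 0 j ^+ 2.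
Proof.
move=> n2 sx.
have [i xi] : exists i, x 0 i != 0.
  apply/existsP; rewrite -negb_forall; apply/negP => /forallP x0.
  have : x = 0 by apply/rowP => i; rewrite mxE; exact/eqP.
  move=> x00; move: sx; rewrite /sphere /= x00 /dot big1 => [|i _].
    by move/esym/eqP; rewrite oner_eq0.
  by rewrite mxE mul0r.
have [j ij] : exists j : 'I_n, i != j.
  have : (1 < #|'I_n|)%N by rewrite card_ord.
  rewrite (cardD1 i) inE /= add1n ltnS => /card_gt0P[j].
  by rewrite !inE andbT eq_sym => ij; exists j.
exists i, j; split => //; apply: ltr_wpDr; first exact: sqr_ge0.
by rewrite exprn_even_gt0.
Qed.

(** For a rotation field [X] the normal part of the covariant derivative of
    [X] along itself is [- |X|^2 (1 + d tau / d nu)], so its vanishing fixes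
    the normal derivative of [tau] where [X] does not vanish. *)
Lemma totally_geodesic_normal (G : 'rV[R]_n -> 'M[R]_n) tau x :
  (2 <= n)%N -> smooth_cbal tau ->
  (forall x, cbal x -> G x = (expR (2 * tau x))%:M) ->
  totally_geodesic_sphere G -> sphere x -> grad_dot qf tau x = -1.
Proof.
move=> n2 st Gt tg sx; have bx : cbal x by rewrite /cbal /= sx.
have [i [j [ij xij]]] := sphere_rotation n2 sx.
have iE u w : inner G x u w = expR (2 * tau x) * dot u w.
  rewrite /inner /dot mulr_sumr; apply: eq_bigr => a _.
  rewrite -(sum_deltar (fun b => expR (2 * tau x) * (u 0 a * w 0 b)) a).
  by apply: eq_bigr => b _; rewrite (Gt _ bx) mxE -mulr_natl; ring.
have nx : normal_at G x x by move=> w xw; rewrite iE xw mulr0.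
have := tg _ _ (smooth_rotation i j) (smooth_rotation i j) (rotation_tangent i j)
  (rotation_tangent i j) x sx x nx.
rewrite iE => /eqP; rewrite mulf_eq0 (gt_eqF (expR_gt0 _)) /= => /eqP.
pose X := rotation i j x.
have Xx : dot x X = 0 by exact: rotation_tangent.
have XX : dot X X = x 0 i ^+ 2 + x 0 j ^+ 2 by exact: rotation_sqr.
pose dX := \sum_a bd a tau x * X 0 a.
have -> : covderiv G (rotation i j) (rotation i j) x =
    \row_l (X 0 j * (i == l)%:R - X 0 i * (j == l)%:R
            + (2 * dX * X 0 l - dot X X * bd l tau x)).
  apply/rowP => l; rewrite [LHS]mxE [RHS]mxE; congr (_ + _).
    rewrite (eq_bigr (fun a => (a == j)%:R * (X 0 a * (i == l)%:R)
        - (a == i)%:R * (X 0 a * (j == l)%:R))).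
      by rewrite sumrB !sum_deltal.
    by move=> a _; rewrite bdE bd_rotation//; ring.
  rewrite (eq_bigr (fun a => (l == a)%:R * (X 0 a * dX) + X 0 l * (bd a tau x * X 0 a)
     - bd l tau x * (X 0 a * X 0 a))); last first.
    move=> a _.
    rewrite (eq_bigr (fun b => (l == b)%:R * (X 0 b * (bd a tau x * X 0 a))
      + (l == a)%:R * X 0 a * (bd b tau x * X 0 b)
      - (a == b)%:R * (bd l tau x * (X 0 a * X 0 b)))).
      by rewrite sumrB big_split /= !sum_deltar -mulr_sumr -/dX; ring.
    by move=> b _; rewrite (conformal_christoffel st Gt _ _ _ bx); ring.
  by rewrite sumrB big_split /= sum_deltar -!mulr_sumr -/dX -/(dot X X); ring.
rewrite [dot _ x]/dot (eq_bigr (fun l => (i == l)%:R * (X 0 j * x 0 l)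
   - (j == l)%:R * (X 0 i * x 0 l)
   + (2 * dX * (x 0 l * X 0 l) - dot X X * (x 0 l * bd l tau x)))); last first.
  by move=> l _; rewrite mxE; ring.
rewrite big_split !sumrB /= !sum_deltar -!mulr_sumr -/(dot x X) Xx -(grad_dot_qfE _ bx).
have Xj : X 0 j = - x 0 i by rewrite mxE eqxx (negbTE ij) /=; ring.
have Xi : X 0 i = x 0 j by rewrite mxE eqxx eq_sym (negbTE ij) /=; ring.
rewrite Xj Xi XX; set s := _ + _ in xij *.
have -> : - x 0 i * x 0 i - x 0 j * x 0 j = - s by rewrite /s; ring.
rewrite mulr0 sub0r => E.
have : s * (1 + grad_dot qf tau x) = 0 by rewrite mulrDr mulr1; move: E; lra.
move/eqP; rewrite mulf_eq0 (gt_eqF xij) /= addrC addr_eq0 => /eqP.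
by [].
Qed.

End Rotation.

Section Components.
Context {R : realType} {n : nat}.
Local Notation N := (n%:R : R).

Lemma components_conformal (g : tensor2 R n) (phi : 'rV[R]_(n + 1) -> R) x :
  (forall p, hemisphere p -> forall u v, tangent p u -> tangent p v ->
     g p u v = phi p * round p u v) ->
  cbal x -> components g x = (phi (stereo x) * expR (2 * tau0 x))%:M.
Proof.
move=> gphi bx; apply/matrixP => i j; rewrite [LHS]mxE [RHS]mxE.
rewrite gphi; last 3 first.
- exact: stereo_hemisphere.
- exact: stereo_tangent.
- exact: stereo_tangent.
rewrite -[RHS]mulr_natl /round (stereo_conformal i j bx).
have -> : expR (2 * tau0 x) = (qf x ^+ 2)^-1 by rewrite expRM_natl expR_tau0 exprVn.
by rewrite mulrCA.
Qed.

Lemma components_round x : cbal x ->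
  components (@round R n) x = (expR (2 * tau0 x))%:M.
Proof.
move=> bx; rewrite (@components_conformal _ (fun=> 1)) ?mul1r//.
by move=> p _ u v _ _; rewrite mul1r.
Qed.

(** A nonzero vector tangent to the equator, again a rotation, detects the
    conformal factor. *)
Lemma boundary_factor (g : tensor2 R n) (phi : 'rV[R]_(n + 1) -> R) x :
  (2 <= n)%N ->
  (forall p, hemisphere p -> forall u v, tangent p u -> tangent p v ->
     g p u v = phi p * round p u v) ->
  (forall p, equator p -> forall u v,
     tangent_equator p u -> tangent_equator p v -> g p u v = round p u v) ->
  sphere x -> phi (stereo x) = 1.
Proof.
move=> n2 gphi gb sx; have bx : cbal x by rewrite /cbal /= sx.
have [i [j [ij xij]]] := sphere_rotation n2 sx.
pose u : 'rV[R]_(n + 1) := row_mx (rotation i j x) 0.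
have hu : height u = 0 by rewrite /height row_mxEr mxE.
have uu : dot u u = x 0 i ^+ 2 + x 0 j ^+ 2.
  by rewrite dot_split hu mulr0 addr0 row_mxKl rotation_sqr.
have tu : tangent (stereo x) u.
  rewrite /tangent dot_split hu mulr0 addr0 row_mxKl lsubmx_stereo dot_rotation.
  by rewrite !mxE; ring.
have := gb _ (stereo_equator sx) u u (conj tu hu) (conj tu hu).
rewrite (gphi _ (stereo_hemisphere bx) u u tu tu) /round uu.
set s := _ + _ in xij * => /eqP.
by rewrite -subr_eq0 -[X in _ - X]mul1r -mulrBl mulf_eq0 (gt_eqF xij) orbF subr_eq0 => /eqP.
Qed.

End Components.

Theorem theorem1 (R : realType) (n : nat) (g : tensor2 R n) :
  (3 <= n)%N ->
  riemannian_metric g ->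
  conformal_to_round g ->
  (forall p, hemisphere p -> Q_curvature round p <= Q_curvature g p) ->
  (forall p, equator p -> forall u v,
     tangent_equator p u -> tangent_equator p v -> g p u v = round p u v) ->
  totally_geodesic_boundary g ->
  (forall p, equator p -> n%:R * (n%:R - 1) <= scalar_curvature g p) ->
  forall p, hemisphere p -> forall u v,
    tangent p u -> tangent p v -> g p u v = round p u v.
Proof.
move=> n3 _ [phi [sphi phi0 gphi]] Qg gb tg Rg.
pose tau y := 2^-1 * ln (phi (stereo y)) + tau0 y.
have phis y : cbal y -> 0 < phi (stereo y).
  by move=> By; apply: phi0; exact: stereo_hemisphere.
have stau : smooth_cbal tau.
  apply: smooth_cbalD; last exact: smooth_tau0.
  by apply: smooth_cbalZ; exact: smooth_cbal_ln.
have Gtau x : cbal x -> components g x = (expR (2 * tau x))%:M.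
  move=> bx; rewrite (components_conformal gphi bx).
  have -> : 2 * tau x = ln (phi (stereo x)) + 2 * tau0 x by rewrite /tau; field.
  by rewrite expRD lnK// posrE phis.
have Qge x : cbal x -> n%:R * (n%:R ^+ 2 - 4) / 8 <= Qcurv (components g) x.
  move=> bx; have := Qg _ (stereo_hemisphere bx).
  by rewrite /Q_curvature stereoK (round_Qcurv n3 (@components_round R n) bx).
have tau_bd x : sphere x -> tau x = 0.
  move=> sx; rewrite /tau (boundary_factor (ltnW n3) gphi gb sx) ln1 mulr0 add0r.
  have -> : tau0 x = - ln 1 by congr (- ln _); rewrite /qf sx; field.
  by rewrite ln1 oppr0.
have dtau_bd x : sphere x -> grad_dot qf tau x = -1.
  exact: totally_geodesic_normal (ltnW n3) stau Gtau tg.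
have scal_bd x : sphere x -> n%:R * (n%:R - 1) <= scalar_curv (components g) x.
  by move=> sx; have := Rg _ (stereo_equator sx); rewrite /scalar_curvature stereoK.
have E := ball_rigidity n3 stau Gtau Qge tau_bd dtau_bd scal_bd.
move=> p hp u v tu tv; rewrite gphi// -{1}(chartK hp).
have bc := chart_cbal hp.
have := E _ bc; rewrite /tau => /eqP.
rewrite addrC -subr_eq0 addrAC subrr add0r mulf_eq0 invr_eq0 pnatr_eq0 /=.
by rewrite ln_eq0 ?phis// => /eqP ->; rewrite mul1r.
Qed.
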